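(* There exists a real number $\alpha>0$ such that for all sufficiently large positive integers $n$, $$\kappa(n)\leq 1+\frac{1}{n^{\alpha}}.$$
   Context: For a real matrix $A$, let $\sigma_{\max}(A)$ and $\sigma_{\min}(A)$ denote its largest and smallest singular values. The condition number of $A$ is $\kappa(A)=\sigma_{\max}(A)/\sigma_{\min}(A)\in[1,\infty]$, with $\kappa(A)=\infty$ if $\sigma_{\min}(A)=0$. For each positive integer $n$, define $\kappa(n):=\min_{A\in\{\pm1\}^{n\times n}}\kappa(A)$, the smallest possible condition number of an $n\times n$ matrix with all entries in $\{\pm1\}$. *)

(* Defs.v *)
From HB Require Import structures.
From mathcomp Require Import all_boot all_order all_algebra.
From mathcomp Require Import all_classical all_reals all_analysis.
Set Implicit Arguments.
Unset Strict Implicit.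
Unset Printing Implicit Defensive.
Import Order.TTheory GRing.Theory Num.Theory.
Local Open Scope classical_set_scope.
Local Open Scope ring_scope.

Definition singular_values (R : realType) (n : nat) (A : 'M[R]_n) : set R :=
  [set s | 0 <= s /\ eigenvalue (A^T *m A) (s ^+ 2)].

(* For 0 < n the set of singular values is finite and nonempty, so that the
   supremum and infimum below are its maximum and minimum. *)
Definition sigma_max (R : realType) (n : nat) (A : 'M[R]_n) : R :=
  sup (singular_values A).

Definition sigma_min (R : realType) (n : nat) (A : 'M[R]_n) : R :=
  inf (singular_values A).

Definition cond_number (R : realType) (n : nat) (A : 'M[R]_n) : \bar R :=
  if sigma_min A == 0 then +oo%E else (sigma_max A / sigma_min A)%:E.

Definition sign_matrices (R : realType) (n : nat) : set 'M[R]_n :=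
  [set A | forall i j, A i j = 1 \/ A i j = -1].

(* There are finitely many sign matrices and at least one, so this infimum is
   a minimum. *)
Definition min_cond_number (R : realType) (n : nat) : \bar R :=
  ereal_inf [set cond_number A | A in @sign_matrices R n].

(* Main.v *)
Require Import Defs.
From HB Require Import structures.
From mathcomp Require Import all_boot all_order all_algebra.
From mathcomp Require Import all_classical all_reals all_analysis.
From mathcomp Require Import complex ring lra zify.
Set Implicit Arguments.
Unset Strict Implicit.
Unset Printing Implicit Defensive.
Import Order.TTheory GRing.Theory Num.Theory.
Local Open Scope ring_scope.

(** Sign matrices with orthogonal rows (Hadamard matrices) have condition number
1 but exist only in special orders.  The proof perturbs a Hadamard matrix of an
order slightly larger than n into an n x n sign matrix that is still orthogonal
up to a relative error that is a negative power of n.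

Supply ([hadamard_order], [hadamard_above]).  If q < 2^b there is a Hadamard
matrix of order 2^(4b+3) (4q+1), so every n < 2^(5b) has a Hadamard order N at
distance r = O(2^(4b)), that is N - n = O(n^(4/5)) for the best b.  Golay pairs
of polynomials, one for each binary digit of q, are evaluated at a cyclic shift.
Their symmetric and skew parts yield O(b) commuting symmetric {0, 1, -1}
matrices whose supports partition all positions and whose squares add up to a
scalar.  A Clifford-type doubling glues them into one orthogonal sign matrix.

Removal ([near_sign_orthogonal]).  A scaled orthogonal X of order 1 + m, with
X X^T = s^2, can be replaced by the scaled orthogonal matrix
X11 + (s - X00)^-1 X10 X01 of order m.  Each entry moves by about 1 / |s|, and
changing the sign of s changes the direction of the motion almost exactly.
Choosing signs greedily against a sum of hyperbolic cosines keeps the entries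
after r removals within about sqrt (r / N), up to logarithms, of 1 or -1: they
behave like a random walk rather than like a drift of size r / sqrt N.

Rounding ([sign_rounding]).  A matrix F with entries in [-1, 1] and
1 - F_ij^2 <= e is within operator norm sqrt (8 e n) of a sign matrix A.  This is
the barrier method of Batson, Spielman and Srivastava: the rows of A are chosen
one at a time so that the trace of (u - (A - F)^T (A - F))^-1 never grows, while
u grows by 4 e for each row.  Only the variances 1 - F_ij^2 enter, and no
logarithm is lost.

Condition number ([cond_number_le]).  If F F^T = d and A - F has operator norm at
most h sqrt d, the singular values of A lie between (1 - h) sqrt d and
(1 + h) sqrt d.

The parameters are powers of 2^g, where 2^(80 (g - 1)) <= n < 2^(80 g).  With
beta = 4^g the removed fraction r / N is O(beta^-8), the entries stay within
beta^-2 of 1 or -1, and the relative error is h = 12 / beta.  Since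
n < 2^(80 g), the resulting 48 / beta is at most n^(-1/80). *)

Definition sign_mx (R : numDomainType) m n (A : 'M[R]_(m, n)) :=
  forall i j, A i j = 1 \/ A i j = -1.

Definition has_hadamard (R : numDomainType) (n : nat) :=
  exists2 H : 'M[R]_n, sign_mx H & H *m H^T = n%:R%:M.

(** * Hadamard matrices from commuting symmetric matrices *)

Section Clifford.
Variable R : numDomainType.

(** The supports of the matrices partition the set of positions: each entry is
0, 1 or -1, so a sum of absolute values equal to 1 leaves exactly one nonzero
entry per position. *)
Definition sign_cover m n (ms : seq 'M[R]_(m, n)) :=
  forall i j, (forall A, A \in ms -> A i j \in [:: 0; 1; -1])
    /\ \sum_(A <- ms) `|A i j| = 1.

Lemma sign0N (x : R) : x \in [:: 0; 1; -1] -> - x \in [:: 0; 1; -1].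
Proof. by rewrite !inE => /or3P[] /eqP ->; rewrite ?oppr0 ?opprK eqxx ?orbT. Qed.

Lemma sign0_addsub (x y : R) : x \in [:: 0; 1; -1] -> y \in [:: 0; 1; -1] ->
  `|x| + `|y| <= 1 ->
  [/\ x + y \in [:: 0; 1; -1], x - y \in [:: 0; 1; -1],
     `|x + y| = `|x| + `|y| & `|x - y| = `|x| + `|y|].
Proof.
move=> hx hy.
have two : ((1 : R) + 1 <= 1) = false by rewrite gerDl ler10.
move: hx hy; rewrite !inE => /or3P[] /eqP -> /or3P[] /eqP ->;
  rewrite ?normrN ?normr0 ?normr1 ?two // => _;
  rewrite ?oppr0 ?opprK ?sub0r ?add0r ?addr0 ?opprK ?normrN ?normr0 ?normr1 ?eqxx ?orbT.
all: by split.
Qed.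

Lemma sum_block_diag (I : eqType) n (r : seq I) (F : I -> 'M[R]_n) :
  \sum_(i <- r) block_mx (F i) 0 0 (F i)
  = block_mx (\sum_(i <- r) F i) 0 0 (\sum_(i <- r) F i).
Proof.
elim: r => [|i r IH]; first by rewrite !big_nil block_mx0.
by rewrite !big_cons IH add_block_mx !addr0.
Qed.

(** If X and T are symmetric and commute then [[X, T], [T, -X]] is symmetric with
square diag (X^2 + T^2, X^2 + T^2), and it commutes with diag (B, B) for every B
that commutes with X and T.  Absorbing the matrices of the list one after the
other thus ends with one symmetric matrix whose square is the scalar c: this is
the sum of the given matrices weighted by anticommuting Clifford generators.  A
generator is only a signed permutation matrix, so the product has many zeros;
the orthogonal factor K, doubled along a Sylvester pattern, spreads each nonzero
entry over a whole block, and the disjoint supports fill all positions. *)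
Lemma hadamard_of_commuting n (X K : 'M[R]_n) (Ts : seq 'M[R]_n) (k c : R) :
  K *m K^T = k%:M ->
  {in X :: Ts, forall A, A^T = A} ->
  {in X :: Ts &, forall A B, A *m B = B *m A} ->
  \sum_(A <- X :: Ts) A *m A = c%:M ->
  sign_cover [seq A *m K | A <- X :: Ts] ->
  k * c = n%:R ->
  has_hadamard R (n * 2 ^ size Ts).
Proof.
have [s] := ubnP (size Ts); elim: s => // s IH in n X K Ts k *.
case: Ts => [_|T Ts /= sTs] KK sym com sumsq cov kc /=.
  rewrite muln1; exists (X *m K).
    move=> i j; have [] := cov i j.
    rewrite /= big_cons big_nil addr0 => /(_ (X *m K)).
    rewrite inE eqxx => /(_ isT).
    rewrite !inE => /or3P[] /eqP ->; [|by left|by right].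
    by rewrite normr0 => /esym/eqP; rewrite oner_eq0.
  move: sumsq; rewrite big_cons big_nil addr0 => sq.
  rewrite trmx_mul mulmxA -(mulmxA X) KK (sym X) ?inE ?eqxx//.
  by rewrite mul_mx_scalar -scalemxAl sq scale_scalar_mx kc.
pose D (A : 'M[R]_n) : 'M[R]_(n + n) := block_mx A 0 0 A.
have -> : (n * 2 ^ (size Ts).+1 = (n + n) * 2 ^ size (map D Ts))%N.
  by rewrite size_map expnS; lia.
have inX : X \in X :: T :: Ts by rewrite inE eqxx.
have inT : T \in X :: T :: Ts by rewrite !inE eqxx orbT.
have inTs A : A \in Ts -> A \in X :: T :: Ts by rewrite !inE => ->; rewrite !orbT.
have XT : X *m T = T *m X by exact: com.
apply: (IH _ (block_mx X T T (- X)) (block_mx K K K (- K)) (map D Ts) (k *+ 2)).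
- by rewrite size_map.
- rewrite tr_block_mx mulmx_block (linearN (trmx)) /= !mulNmx !mulmxN opprK KK subrr.
  by rewrite scalar_mx_block mulr2n raddfD.
- move=> A; rewrite inE => /predU1P[->|/mapP[B BTs ->]].
    by rewrite tr_block_mx (linearN trmx) /= !sym.
  by rewrite tr_block_mx trmx0 sym ?inTs.
- have cX B : B \in Ts -> block_mx X T T (- X) *m D B = D B *m block_mx X T T (- X).
    move=> BTs; rewrite !mulmx_block !mul0mx !mulmx0 !addr0 !add0r mulNmx mulmxN.
    by rewrite (com X B inX (inTs _ BTs)) (com T B inT (inTs _ BTs)).
  move=> A B; rewrite !inE => /predU1P[->|/mapP[A' ATs ->]] /predU1P[->|/mapP[B' BTs ->]] //.
  - exact: cX.
  - by rewrite cX.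
  - by rewrite !mulmx_block !mul0mx !mulmx0 !addr0 !add0r (com A' B' (inTs _ ATs) (inTs _ BTs)).
- rewrite big_cons big_map.
  under eq_bigr => A _ do
    rewrite mulmx_block !mul0mx !mulmx0 !addr0 !add0r.
  rewrite sum_block_diag mulmx_block mulmxN !mulNmx mulmxN opprK XT subrr add_block_mx addr0.
  rewrite scalar_mx_block -sumsq !big_cons addrA.
  by rewrite (addrC (T *m T) (X *m X)).
- { have KE A : D A *m block_mx K K K (- K) =
     block_mx (A *m K) (A *m K) (A *m K) (- (A *m K)).
    by rewrite mulmx_block !mul0mx !addr0 !add0r mulmxN.
  have XE : block_mx X T T (- X) *m block_mx K K K (- K) =
     block_mx (X *m K + T *m K) (X *m K - T *m K) (T *m K - X *m K) (T *m K + X *m K).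
    by rewrite mulmx_block !mulmxN !mulNmx opprK.
  pose bm (A : 'M[R]_n) := block_mx A A A (- A).
  pose W := block_mx (X *m K + T *m K) (X *m K - T *m K)
                     (T *m K - X *m K) (T *m K + X *m K).
  have -> : [seq A *m block_mx K K K (- K) | A <- block_mx X T T (- X) :: map D Ts] =
     W :: map bm [seq A *m K | A <- Ts].
    by rewrite /= XE -map_comp -[in RHS]map_comp; congr cons; apply: eq_map => A /=; rewrite KE.
  have NE (A : 'M[R]_n) i j : (- A) i j = - A i j by rewrite mxE.
  have covE (x : 'M[R]_(n + n)) i j i' j' :
    (forall A, `|bm A i j| = `|A i' j'| /\ (A i' j' \in [:: 0; 1; -1] -> bm A i j \in [:: 0; 1; -1])) ->
    x i j \in [:: 0; 1; -1] -> `|x i j| = `|(X *m K) i' j'| + `|(T *m K) i' j'| ->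
    (forall A, A \in x :: map bm [seq A *m K | A <- Ts] -> A i j \in [:: 0; 1; -1])
    /\ \sum_(A <- x :: map bm [seq A *m K | A <- Ts]) `|A i j| = 1.
    move=> hbm hx ex; have [cov1 cov2] := cov i' j'; split.
      move=> A; rewrite inE => /predU1P[->//|/mapP[B BTs ->]].
      by apply: (hbm B).2; apply: cov1; rewrite /= !inE BTs !orbT.
    rewrite big_cons big_map ex -cov2 /= !big_cons addrA; congr (_ + _).
    by apply: eq_bigr => A _; rewrite (hbm A).1.
  have xt i' j' : [/\ (X *m K) i' j' \in [:: 0; 1; -1],
     (T *m K) i' j' \in [:: 0; 1; -1] & `|(X *m K) i' j'| + `|(T *m K) i' j'| <= 1].
    have [cov1 cov2] := cov i' j'; split; first by apply: cov1; rewrite /= inE eqxx.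
      by apply: cov1; rewrite /= !inE eqxx orbT.
    by rewrite -cov2 /= !big_cons addrA lerDl sumr_ge0.
  move=> i j.
  case: (split_ordP i) => i' ->; case: (split_ordP j) => j' ->;
    have [hx ht hxt] := xt i' j'; have [h1 h2 h3 h4] := sign0_addsub hx ht hxt;
    apply: (covE W _ _ i' j').
  all: try by move=> A; rewrite /bm ?block_mxEul ?block_mxEur ?block_mxEdl ?block_mxEdr;
    rewrite ?NE ?normrN; split => // /sign0N.
  all: rewrite /W ?block_mxEul ?block_mxEur ?block_mxEdl ?block_mxEdr mxE ?NE //.
  - by rewrite -opprB; apply: sign0N.
  - by rewrite distrC.
  - by rewrite addrC.
  - by rewrite addrC.
}
- rewrite mulrnAl kc -mulr_natr -natrM; congr (_%:R); lia.
Qed.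
End Clifford.

(** * Golay pairs of circulant matrices *)

Section Circulant.
Variables (R : numDomainType) (m : nat).
Notation M := m.+2.

Definition circ (a : 'I_M -> R) : 'M[R]_M := \matrix_(i, j) a (j - i).

Lemma circC a b : circ a *m circ b = circ b *m circ a.
Proof.
apply/matrixP => i j; rewrite !mxE (reindex_inj (inj_comp (addrI (i + j)) oppr_inj)) /=.
apply: eq_bigr => k _; rewrite !mxE mulrC; congr (b _ * a _); ring.
Qed.

Lemma tr_circ a : (circ a)^T = circ (fun d => a (- d)).
Proof. by apply/matrixP => i j; rewrite !mxE opprB. Qed.

Definition shift_mx : 'M[R]_M := circ (fun d => (d == 1)%:R).

Lemma shift_mxX k : shift_mx ^+ k = circ (fun d => (d == k%:R)%:R).
Proof.
elim: k => [|k IH]; apply/matrixP => i j.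
  by rewrite expr0 !mxE subr_eq0 eq_sym.
rewrite exprS IH !mxE (bigD1 (i + 1)) //= !mxE addrAC subrr add0r eqxx mul1r.
rewrite big1 ?addr0 => [|l]; first by rewrite opprD addrA subr_eq -natr1.
by rewrite !mxE subr_eq addrC => /negPf ->; rewrite mul0r.
Qed.

Definition pshift (p : {poly R}) := horner_mx shift_mx p.

Lemma pshiftE (p : {poly R}) : (size p <= M)%N -> pshift p = circ (fun d => p`_d).
Proof.
move=> sp; have -> : pshift p = \sum_(k < M) p`_k *: shift_mx ^+ k.
  rewrite -[in LHS](take_poly_id sp) /take_poly poly_def [pshift _]rmorph_sum /=.
  by apply: eq_bigr => k _; rewrite horner_mxZ rmorphXn /= horner_mx_X.
apply/matrixP => i j; rewrite summxE mxE (bigD1 (j - i)) // mxE shift_mxX mxE.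
rewrite natr_Zp eqxx mulr1 big1; first exact: addr0.
by move=> k kd; rewrite mxE shift_mxX mxE natr_Zp eq_sym (negPf kd) mulr0.
Qed.

Lemma shift_mxXX k : shift_mx ^+ k *m (shift_mx ^+ k)^T = 1%:M.
Proof.
rewrite shift_mxX; apply/matrixP => i j; rewrite !mxE (bigD1 (i + k%:R)) //=.
rewrite !mxE [i + _]addrC addrK eqxx mul1r -addrA -subr_eq0 addrAC subrr add0r subr_eq0.
rewrite big1 ?addr0 // => l.
by rewrite !mxE subr_eq => /negPf ->; rewrite mul0r.
Qed.

Definition energy (p : {poly R}) := pshift p *m (pshift p)^T.

Lemma energy0 : energy 0 = 0.
Proof. by rewrite /energy /pshift rmorph0 mul0mx. Qed.

(** Multiplying by a power of the variable multiplies the matrix by an orthogonal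
one, so a sequence can be translated without changing its autocorrelation. *)
Lemma energyXn k p : energy ('X^k * p) = energy p.
Proof.
rewrite /energy; have -> : pshift ('X^k * p) = pshift p *m shift_mx ^+ k.
  by rewrite /pshift mulrC rmorphM rmorphXn /= horner_mx_X.
by rewrite trmx_mul mulmxA -(mulmxA (pshift p)) shift_mxXX mulmx1.
Qed.

Lemma energy_parallelogram p q :
  energy (p + q) + energy (p - q) = (energy p + energy q) *+ 2.
Proof.
rewrite /energy /pshift rmorphD rmorphB (linearD trmx) (linearB trmx) /=.
move: (horner_mx _ p) (horner_mx _ q) => a b.
rewrite !(mulmxDl, mulmxDr, mulNmx, mulmxN) mulr2n opprK.
set x := a *m a^T; set y := b *m a^T; set z := a *m b^T; set t := b *m b^T.
by rewrite addrACA [x + z + _]addrACA [y + t + _]addrACA !subrr addr0 add0r addrACA.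
Qed.

(** The Rudin-Shapiro recursion: both members have coefficients 1 or -1 up to
degree 2^a - 1, and by the parallelogram identity their energies, which are the
autocorrelations of the coefficient sequences, add up to a scalar. *)
Fixpoint golay a : {poly R} * {poly R} :=
  if a is a'.+1 then
    let: (p, q) := golay a' in (p + 'X^(2 ^ a') * q, p - 'X^(2 ^ a') * q)
  else (1, 1).

Lemma golay_energy a : energy (golay a).1 + energy (golay a).2 = (2 ^ a.+1)%:R%:M.
Proof.
elim: a => [|a] /=.
  by rewrite /energy /pshift rmorph1 trmx1 mul1mx -raddfD.
case: (golay a) => p q /= IH; rewrite energy_parallelogram energyXn IH.
by rewrite -raddfMn -mulrnA mulnC -expnS.
Qed.

Lemma golay_coef a k :
  [/\ (golay a).1`_k \in [:: 0; 1; -1], (golay a).2`_k \in [:: 0; 1; -1],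
     `|(golay a).1`_k| = (k < 2 ^ a)%:R & `|(golay a).2`_k| = (k < 2 ^ a)%:R].
Proof.
elim: a k => [|a IH] k /=.
  by rewrite coef1 expn0 ltnS leqn0; case: (k == 0)%N; rewrite ?normr1 ?normr0 !inE !eqxx ?orbT.
case: (golay a) IH => p q /= IH.
rewrite !coefE; have [p1 q1 p2 q2] := IH k.
have -> : (k < 2 ^ a.+1)%:R = (k < 2 ^ a)%:R + (2 ^ a <= k < 2 ^ a.+1)%:R :> R.
  rewrite -natrD; congr (_%:R); rewrite expnS.
  case: (ltnP k (2 ^ a)%N) => /= h; last by case: (_ < _)%N.
  by suff -> : (k < 2 * 2 ^ a)%N by []; lia.
have [kl|kg] := ltnP k (2 ^ a)%N.
  by rewrite /= !(addr0, subr0) p2 kl.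
have [p1' q1' p2' q2'] := IH (k - 2 ^ a)%N.
have -> : p`_k = 0 by apply/eqP; rewrite -normr_eq0 p2 ltnNge kg.
rewrite !add0r normrN q2'.
have -> : (k - 2 ^ a < 2 ^ a)%N = (k < 2 ^ a.+1)%N by rewrite expnS; lia.
by split => //; apply: sign0N.
Qed.

(** A binary digit 2^b of q contributes the two members of a Golay pair of length
2^b, translated to consecutive intervals; a digit 0 contributes two zero
polynomials, which makes the number of pieces depend on b only. *)
Lemma golay_pieces b q c : (q < 2 ^ b)%N ->
  exists L : seq {poly R}, [/\ size L = (2 * b)%N,
    forall k p, p \in L -> p`_k \in [:: 0; 1; -1],
    forall k, \sum_(p <- L) `|p`_k| = (c <= k < c + 2 * q)%:R &
    \sum_(p <- L) energy p = (2 * q)%:R%:M].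
Proof.
elim: b q c => [|b IH] q c qb.
  have -> : q = 0 by move: qb; rewrite expn0; lia.
  exists [::]; split => // [k|]; rewrite big_nil ?raddf0 //.
  by rewrite muln0 addn0; case: ltngtP.
have [ql|qg] := ltnP q (2 ^ b)%N.
  have [L [sL L1 L2 L3]] := IH q c ql.
  exists [:: 0, 0 & L]; split=> /=; first by rewrite sL; lia.
  - move=> k p; rewrite 2!inE => /or3P[/eqP->|/eqP->|/L1//]; by rewrite coef0 inE eqxx.
  - by move=> k; rewrite !big_cons !coef0 normr0 !add0r.
  - by rewrite !big_cons energy0 !add0r.
have [|L [sL L1 L2 L3]] := IH (q - 2 ^ b)%N (c + 2 ^ b.+1)%N.
  by move: qb; rewrite expnS; lia.
exists [:: 'X^c * (golay b).1, 'X^(c + 2 ^ b) * (golay b).2 & L]; split=> /=.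
- by rewrite sL; lia.
- move=> k p; rewrite 2!inE => /or3P[/eqP->|/eqP->|/L1//]; rewrite coefXnM;
    (case: ifP => _; first by rewrite inE eqxx).
    by have [] := golay_coef b (k - c).
  by have [] := golay_coef b (k - (c + 2 ^ b)).
- move=> k; rewrite !big_cons !coefXnM L2.
  have [_ _ h1 _] := golay_coef b (k - c).
  have [_ _ _ h2] := golay_coef b (k - (c + 2 ^ b)).
  rewrite (fun_if Num.norm) (fun_if Num.norm) h1 h2 normr0.
  have E x y : (if (x < y)%N then 0 else (x - y < 2 ^ b)%N%:R) = (y <= x < y + 2 ^ b)%:R :> R.
    case: ltnP => //= yx; congr (_%:R); congr (nat_of_bool _); lia.
  rewrite !E.
  rewrite -!natrD; congr (_%:R); rewrite expnS; move: qg; set e := (2 ^ b)%N => qg; lia.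
- rewrite !big_cons !energyXn L3 addrA golay_energy -raddfD -natrD; congr (_%:R%:M).
  by rewrite expnS; lia.
Qed.

End Circulant.

(** * Hadamard matrices of order 2^(4b+3) (4q+1) *)

Section Supply.
Variable (R : numDomainType).

Definition is_circ m (A : 'M[R]_m.+2) := exists a, A = circ a.

Section Closure.
Variable m : nat.
Implicit Types A B : 'M[R]_m.+2.

Lemma is_circC A B : is_circ A -> is_circ B -> A *m B = B *m A.
Proof. by move=> [a ->] [b ->]; exact: circC. Qed.

Lemma is_circD A B : is_circ A -> is_circ B -> is_circ (A + B).
Proof.
by move=> [a ->] [b ->]; exists (fun d => a d + b d); apply/matrixP => i j; rewrite !mxE.
Qed.

Lemma is_circN A : is_circ A -> is_circ (- A).
Proof. by move=> [a ->]; exists (fun d => - a d); apply/matrixP => i j; rewrite !mxE. Qed.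

Lemma is_circT A : is_circ A -> is_circ A^T.
Proof. by move=> [a ->]; exists (fun d => a (- d)); rewrite tr_circ. Qed.

Lemma is_circM A B : is_circ A -> is_circ B -> is_circ (A *m B).
Proof.
move=> [a ->] [b ->]; exists (fun d => \sum_k a k * b (d - k)).
apply/matrixP => i j; rewrite !mxE (reindex_inj (addIr i)) /=.
by apply: eq_bigr => k _; rewrite !mxE addrK opprD addrA addrAC.
Qed.

Lemma is_circ0 : is_circ (0 : 'M[R]_m.+2).
Proof. by exists (fun=> 0); apply/matrixP => i j; rewrite !mxE. Qed.

Lemma is_circX k : is_circ (shift_mx R m ^+ k).
Proof. by rewrite shift_mxX; eexists. Qed.

Lemma shift_mxX_mull k A i j : (shift_mx R m ^+ k *m A) i j = A (i + k%:R) j.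
Proof.
rewrite shift_mxX !mxE (bigD1 (i + k%:R)) //= !mxE [i + _]addrC addrK eqxx mul1r.
by rewrite big1 ?addr0 // => l; rewrite !mxE subr_eq => /negPf ->; rewrite mul0r.
Qed.

End Closure.

Lemma val_oppI m (d : 'I_m.+2) : val (- d) = if (d : nat) == 0%N then 0%N else (m.+2 - d)%N.
Proof.
rewrite /=; case: eqP => [->|/eqP d0]; first by rewrite subn0 modnn.
by rewrite modn_small // ltn_subrL lt0n d0.
Qed.

Lemma val_subI m (d e : 'I_m.+2) :
  val (d - e) = if (d < e)%N then (d + m.+2 - e)%N else (d - e)%N.
Proof.
rewrite /= modnDmr addnBA ?(ltnW (ltn_ord e)) //.
have hd := ltn_ord d; have he := ltn_ord e.
case: ltnP => h; first by rewrite modn_small //; lia.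
have -> : (d + m.+2 - e = d - e + m.+2)%N by lia.
by rewrite modnDr modn_small //; lia.
Qed.

(** With P the interval from 1 to 2q, the cyclic group of order 8q + 2 with its
element mu = 4q + 1 of order two is the disjoint union of 0, mu, P, -P, mu + P
and mu - P.  Here [op] and [sb] are x |-> -x and x |-> x - mu on representatives. *)
Lemma parts_nat q x (P := fun k => (1 <= k < 1 + 2 * q)%N)
  (op := fun y => if y == 0%N then 0%N else ((8 * q).+2 - y)%N)
  (sb := fun y => if (y < 4 * q + 1)%N then (y + (8 * q).+2 - (4 * q + 1))%N
                  else (y - (4 * q + 1))%N) : (x < (8 * q).+2)%N ->
  ((x == 0) + (x == 4 * q + 1) + (P x + P (op x)) + (P (sb x) + P (op (sb x))) = 1)%N.
Proof.
rewrite /op /sb /P => hx; case: (ltnP x (4 * q + 1)) => h.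
  have -> : (x + (8 * q).+2 - (4 * q + 1) == 0)%N = false by apply/eqP; lia.
  case: eqP => h0; first by lia.
  have -> : (1 <= (8 * q).+2 - x < 1 + 2 * q)%N = false by apply/negP; lia.
  have -> : (1 <= x + (8 * q).+2 - (4 * q + 1) < 1 + 2 * q)%N = false by apply/negP; lia.
  lia.
have -> : (x == 0)%N = false by apply/eqP; lia.
have -> : (1 <= x < 1 + 2 * q)%N = false by apply/negP; lia.
case: eqP => h0; case: eqP => h1; lia.
Qed.

Lemma parts_ord q (mu : 'I_(8 * q).+2) (P := fun k => (1 <= k < 1 + 2 * q)%N) :
  (mu : nat) = (4 * q + 1)%N -> forall d : 'I_(8 * q).+2,
  (((d : nat) == 0) + ((d : nat) == 4 * q + 1)
     + (P d + P (- d : 'I_(8 * q).+2)%R)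
     + (P (d - mu : 'I_(8 * q).+2)%R + P (- (d - mu) : 'I_(8 * q).+2)%R) = 1)%N.
Proof.
move=> vmu d; have vo (x : 'I_(8 * q).+2) : nat_of_ord (- x) =
    if (x : nat) == 0%N then 0%N else ((8 * q).+2 - x)%N by exact: val_oppI.
have vd : nat_of_ord (d - mu) = if (d < 4 * q + 1)%N then (d + (8 * q).+2 - (4 * q + 1))%N
    else (d - (4 * q + 1))%N by rewrite -vmu; exact: val_subI.
by rewrite !vo vd; exact: parts_nat.
Qed.

(** For a piece U of a Golay pair, the circulants U + U^T and h (U - U^T), where h
is the shift by the element of order two, are symmetric and skew, and the square
of the first minus the square of the second is 4 U U^T, whose sum over the pieces
is a scalar.  Writing a skew circulant b as the symmetric block matrix
[[0, b], [-b, 0]], whose square is diag (-b^2, -b^2), turns these differences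
into sums of squares without destroying commutation. *)
Lemma hadamard_order b q : (q < 2 ^ b)%N -> has_hadamard R (2 ^ (4 * b + 3) * (4 * q + 1)).
Proof.
move=> qb; pose m := (8 * q)%N.
have [L [sL L1 L2 L3]] := @golay_pieces R m b q 1 qb.
pose mu : 'I_m.+2 := (4 * q + 1)%:R.
have vmu : (mu : nat) = (4 * q + 1)%N by rewrite /mu Zp_nat /= modn_small // /m; lia.
have mu2 : - mu = mu.
  apply: val_inj; rewrite val_oppI [val mu]vmu vmu /m; case: eqP; lia.
pose h : 'M[R]_m.+2 := shift_mx R m ^+ (4 * q + 1).
pose U (p : {poly R}) := pshift m p.
pose S p := U p + (U p)^T.
pose K p := h *m (U p - (U p)^T).
have size_L p : p \in L -> (size p <= m.+2)%N.
  move=> pL; apply/leq_sizeP => k hk; apply/eqP; rewrite -normr_eq0.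
  have := L2 k; have -> : (1 <= k < 1 + 2 * q)%N = false by move: hk; rewrite /m; lia.
  by move/eqP; rewrite psumr_eq0 // => /allP /(_ _ pL).
have UE p : p \in L -> U p = circ (fun d => p`_d) by move=> /size_L /pshiftE.
have circU p : p \in L -> is_circ (U p) by move=> /UE ->; eexists.
have circh : is_circ h by apply: is_circX.
have circ1 : is_circ (1%:M : 'M[R]_m.+2) by exact: (is_circX m 0).
have hT : h^T = h.
  rewrite /h shift_mxX tr_circ; apply/matrixP => i j; rewrite !mxE -/mu.
  by rewrite -{1}mu2 (inj_eq oppr_inj).
have hh : h *m h = 1%:M by rewrite -{2}hT shift_mxXX.
have KT p : p \in L -> (K p)^T = - K p.
  move=> pL; rewrite /K trmx_mul hT linearB /= trmxK.
  rewrite (is_circC (B := h)) //; last first.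
    by apply: is_circD; [apply: is_circT|apply: is_circN]; apply: circU.
  by rewrite -mulmxN opprB.
have SK p : p \in L -> S p *m S p - K p *m K p = energy m p *+ 4.
  move=> pL; rewrite /K -mulmxA (mulmxA (U p - _)) (is_circC (A := U p - _) (B := h)) //; last first.
    by apply: is_circD; [|apply: is_circN; apply: is_circT]; apply: circU.
  rewrite -(mulmxA h (U p - _)) (mulmxA h h) hh mul1mx /S /energy -/(U p).
  have cU : (U p)^T *m U p = U p *m (U p)^T.
    by apply: is_circC; [apply: is_circT|]; apply: circU.
  rewrite !(mulmxDl, mulmxDr, mulNmx, mulmxN) cU opprK.
  by apply/matrixP => i j; rewrite !mxE; ring.
(* The algebra of pairs (a, b) with product that of a + i b. *)
pose T (ab : 'M[R]_m.+2 * 'M[R]_m.+2) := block_mx ab.1 ab.2 (- ab.2) ab.1.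
pose tl : seq ('M[R]_m.+2 * 'M[R]_m.+2) := flatten [seq [:: (S p, 0); (0, K p)] | p <- L].
pose pairs' := (h, 0) :: tl.
pose pairs := (1%:M, 0) :: pairs'.
have size_tl : size tl = (4 * b)%N.
  rewrite /tl size_flatten /shape -map_comp sumnE big_map /= big_const_seq count_predT sL /=.
  by rewrite iter_addn_0; lia.
have pairsP ab : ab \in pairs ->
    [/\ is_circ ab.1, is_circ ab.2, ab.1^T = ab.1 & ab.2^T = - ab.2].
  have circ0 := @is_circ0 m.
  rewrite !inE => /or3P[/eqP->|/eqP->|] /=; try by rewrite ?trmx1 ?hT ?trmx0 ?oppr0; split.
  case/flattenP => l /mapP[p pL ->]; rewrite !inE => /orP[]/eqP-> /=; split=> //.
  - by apply: is_circD; [|apply: is_circT]; apply: circU.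
  - by rewrite /S linearD /= trmxK addrC.
  - by rewrite trmx0 oppr0.
  - apply: is_circM => //; apply: is_circD; [|apply: is_circN; apply: is_circT]; exact: circU.
  - by rewrite trmx0.
  - exact: KT.
have -> : (2 ^ (4 * b + 3) * (4 * q + 1) = (m.+2 + m.+2) * 2 ^ size (map T pairs'))%N.
  have -> : size (map T pairs') = (4 * b).+1 by rewrite size_map /= size_tl.
  rewrite (addnC _ 3) expnD expnS (_ : 2 ^ 3 = 8)%N // /m; move: (2 ^ (4 * b))%N => e; nia.
apply: (@hadamard_of_commuting R _ (T (1%:M, 0)) (block_mx 1%:M 1%:M 1%:M (- 1%:M))
  (map T pairs') 2 m.+2%:R).
- by rewrite tr_block_mx linearN /= !trmx1 mulmx_block !mulmxN !mulNmx !mulmx1 opprK subrr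
    -raddfD -scalar_mx_block.
- rewrite -[T _ :: _]/(map T pairs) => _ /mapP[ab /pairsP[_ _ ha hb] ->].
  by rewrite /T tr_block_mx linearN /= ha hb opprK.
- rewrite -[T _ :: _]/(map T pairs) => A B hA hB.
  have [[a b0] /pairsP[/= ca cb _ _] ->] := mapP hA.
  have [[a' b'] /pairsP[/= ca' cb' _ _] ->] := mapP hB.
  rewrite /T /= !mulmx_block !mulmxN !mulNmx.
  rewrite (is_circC ca ca') (is_circC ca cb') (is_circC cb ca') (is_circC cb cb').
  by rewrite [b' *m a + _]addrC [- (a' *m b0) - _]addrC.
- rewrite -[T _ :: _]/(map T pairs) big_map /pairs !big_cons big_flatten big_map /=.
  have TT a b0 : T (a, b0) *m T (a, b0) = block_mx (a *m a - b0 *m b0) (a *m b0 + b0 *m a)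
      (- (b0 *m a) - a *m b0) (- (b0 *m b0) + a *m a).
    by rewrite /T mulmx_block /= !mulmxN !mulNmx.
  have -> : \sum_(p <- L) \sum_(j <- [:: (S p, 0); (0, K p)]) T j *m T j =
     \sum_(p <- L) block_mx (energy m p *+ 4) 0 0 (energy m p *+ 4).
    apply: eq_big_seq => p pL; rewrite !big_cons big_nil addr0 !TT.
    rewrite !(mul0mx, mulmx0, oppr0, addr0, add0r, subr0) add_block_mx !addr0.
    by rewrite SK.
  rewrite sum_block_diag !TT hh !(mul0mx, mulmx0, mulmx1, oppr0, addr0, add0r, subr0).
  rewrite !add_block_mx !addr0 sumrMnl L3 -raddfMn -!raddfD -scalar_mx_block.
  rewrite -mulrnA -[1]/(1%:R) -!natrD.
  by congr (_%:R%:M); rewrite /m; lia.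
- rewrite -[T _ :: _]/(map T pairs) -map_comp.
  (* The factor K0 fills the zero block that T (a, 0) or T (0, b) has. *)
  pose K0 : 'M[R]_(m.+2 + m.+2) := block_mx 1%:M 1%:M 1%:M (- 1%:M).
  have TK a b0 : T (a, b0) *m K0 = block_mx (a + b0) (a - b0) (a - b0) (- (a + b0)).
    by rewrite /T /K0 mulmx_block /= !mulmxN !mulmx1 opprD (addrC (- b0) a) (addrC (- b0) (- a)).
  have zero_or ab : ab \in pairs -> ab.1 = 0 \/ ab.2 = 0.
    rewrite !inE => /or3P[/eqP->|/eqP->|/flattenP[l /mapP[p pL ->]]] /=; try by right.
    by rewrite !inE => /orP[]/eqP-> /=; [right|left].
  pose P (k : nat) := (1 <= k < 1 + 2 * q)%N.
  have halves (x : 'I_m.+2) (p : {poly R}) : (P x + P (- x : 'I_m.+2)%R <= 1)%N -> p \in L ->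
      [/\ p`_x + p`_(- x) \in [:: 0; 1; -1], p`_x - p`_(- x) \in [:: 0; 1; -1],
        `|p`_x + p`_(- x)| = `|p`_x| + `|p`_(- x)| &
        `|p`_x - p`_(- x)| = `|p`_x| + `|p`_(- x)|].
    move=> Px pL; apply: sign0_addsub; try exact: L1.
    have le (k : nat) : `|p`_k| <= (P k)%:R.
      by rewrite -L2 (big_rem p) //= lerDl sumr_ge0.
    by apply: le_trans (lerD (le _) (le _)) _; rewrite -natrD (ler_nat _ _ 1).
  have parts (d : 'I_m.+2) : ((d == 0%R) + (d == mu) + (P d + P (- d : 'I_m.+2)%R)
      + (P (d - mu : 'I_m.+2)%R + P (- (d - mu) : 'I_m.+2)%R) = 1)%N.
    by have := parts_ord vmu d; rewrite -vmu.
  have cover i j : (forall ab, ab \in pairs ->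
        ab.1 i j \in [:: 0; 1; -1] /\ ab.2 i j \in [:: 0; 1; -1]) /\
      \sum_(ab <- pairs) (`|ab.1 i j| + `|ab.2 i j|) = 1.
    pose d := j - i; pose e := d - mu.
    have pd := parts d.
    have hE p : p \in L -> S p i j = p`_d + p`_(- d) /\ K p i j = p`_e - p`_(- e).
      have e1 : j - (i + mu) = e by rewrite /e /d opprD addrA.
      have e2 : i + mu - j = - e by rewrite -e1 opprB.
      have d2 : i - j = - d by rewrite opprB.
      by move=> pL; rewrite /K shift_mxX_mull /S (UE p pL) !mxE -/mu e1 e2 d2.
    have b01 (c : bool) : c%:R \in [:: 0; 1; -1 : R].
      by case: c; rewrite !inE eqxx ?orbT.
    have z0 : (0 : 'M[R]_m.+2) i j = 0 by rewrite mxE.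
    have zero01 : (0 : 'M[R]_m.+2) i j \in [:: 0; 1; -1] by rewrite z0 inE eqxx.
    have Pd : (P d + P (- d : 'I_m.+2)%R <= 1)%N.
      by rewrite -pd -addnA addnCA; apply: leq_addr.
    have Pe : (P e + P (- e : 'I_m.+2)%R <= 1)%N by rewrite -pd; apply: leq_addl.
    have h1 : (1%:M : 'M[R]_m.+2) i j = (d == 0)%:R by rewrite mxE /d subr_eq0 eq_sym.
    have h2 : h i j = (d == mu)%:R by rewrite /h shift_mxX mxE.
    split.
      move=> ab; rewrite ![ab \in _]in_cons => /or3P[/eqP->|/eqP->|/flattenP[l /mapP[p pL ->]]].
      - by rewrite h1; split; [exact: b01|].
      - by rewrite h2; split; [exact: b01|].
      - have [hS hK] := hE p pL; have [s1 _ _ _] := halves d p Pd pL.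
        have [_ s2 _ _] := halves e p Pe pL.
        by rewrite in_cons mem_seq1 => /orP[]/eqP-> /=; rewrite ?hS ?hK; split.
    rewrite !big_cons /= h1 h2 !z0 normr0 !addr0 !normr_nat big_flatten big_map /=.
    have -> : \sum_(p <- L) \sum_(ab <- [:: (S p, 0); (0, K p)]) (`|ab.1 i j| + `|ab.2 i j|)
       = \sum_(p <- L) ((`|p`_d| + `|p`_(- d)|) + (`|p`_e| + `|p`_(- e)|)).
      apply: eq_big_seq => p pL; rewrite !big_cons big_nil /= !z0 normr0 !addr0 add0r.
      have [hS hK] := hE p pL; have [_ _ s1 _] := halves d p Pd pL.
      by have [_ _ _ s2] := halves e p Pe pL; rewrite hS hK s1 s2.
    rewrite !big_split /= !L2 -!natrD -[RHS]/(1%:R); congr (_%:R).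
    by rewrite -[RHS]pd !addnA.
  move=> i j; suff [i' [j' ij]] : exists i' j', forall ab, ab \in pairs ->
      ((T ab *m K0) i j \in [:: 0; 1; -1]) /\ `|(T ab *m K0) i j| = `|ab.1 i' j'| + `|ab.2 i' j'|.
    have [_ c1] := cover i' j'; split=> [_ /mapP[ab abp ->]|]; first by case: (ij ab abp).
    by rewrite big_map -[RHS]c1; apply: eq_big_seq => ab abp; case: (ij ab abp).
  have ent (i' j' : 'I_m.+2) ab : ab \in pairs -> forall x,
      [\/ x = ab.1 i' j' + ab.2 i' j', x = ab.1 i' j' - ab.2 i' j'
        | x = - (ab.1 i' j' + ab.2 i' j')] ->
      x \in [:: 0; 1; -1] /\ `|x| = `|ab.1 i' j'| + `|ab.2 i' j'|.
    move=> abp; have [/(_ ab abp)[ha hb] _] := cover i' j'.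
    by case: (zero_or ab abp) => ab0 x [] ->; move: ha hb;
      rewrite ab0 mxE normr0 !(add0r, sub0r, addr0, oppr0, subr0) ?normrN => ha hb;
      split => //; apply: sign0N.
  case: (split_ordP i) => i' ->; case: (split_ordP j) => j' ->; exists i', j';
    case=> a b0 abp; apply: (ent i' j' (a, b0) abp); rewrite TK.
  1-4: rewrite ?block_mxEul ?block_mxEur ?block_mxEdl ?block_mxEdr !mxE.
  - exact: Or31.
  - exact: Or32.
  - exact: Or32.
  - exact: Or33.
- by rewrite -natrM /m; congr (_%:R); lia.
Qed.
End Supply.

(** * Removing one row and one column from an orthogonal matrix *)

Section Removal.
Variable R : realType.

(** The map induced on the other coordinates when the coordinate 0 of the output is
required to be s times that of the input.  If X multiplies all norms by |s|, the
contributions of the coordinate 0 to input and output are in the same ratio, and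
so are those of the other coordinates. *)
Definition compress m (X : 'M[R]_(1 + m)) (s : R) : 'M[R]_m :=
  drsubmx X + (s - X 0 0)^-1 *: (dlsubmx X *m ursubmx X).

Lemma compressE m (X : 'M[R]_(1 + m)) s i j :
  compress X s i j = X (rshift 1 i) (rshift 1 j)
    + X (rshift 1 i) 0 * X 0 (rshift 1 j) / (s - X 0 0).
Proof.
rewrite !mxE big_ord1 !mxE mulrC; congr (_ + X _ _ * X _ _ / _); exact: val_inj.
Qed.

Lemma compress_orthogonal m (X : 'M[R]_(1 + m)) s : s != X 0 0 ->
  X *m X^T = (s ^+ 2)%:M -> compress X s *m (compress X s)^T = (s ^+ 2)%:M.
Proof.
rewrite /compress => sx hX; set x := X 0 0 in sx *.
have xE : ulsubmx X = x%:M.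
  apply/matrixP => i j; rewrite !mxE !ord1 eqxx mulr1n /x; congr (X _ _); exact: val_inj.
move: hX; rewrite -(submxK X) block_mxKur block_mxKdl block_mxKdr xE {xE}.
move: x sx (ursubmx X) (dlsubmx X) (drsubmx X) => x sx b u Y.
rewrite tr_block_mx mulmx_block scalar_mx_block tr_scalar_mx => /eq_block_mx[h1 h2 h3 h4].
have bb : b *m b^T = (s ^+ 2 - x ^+ 2)%:M.
  by rewrite raddfB /= -h1 -scalar_mxM -expr2 addrC addKr.
have Yb : Y *m b^T = - x *: u.
  by move/eqP: h3; rewrite addrC addr_eq0 mul_mx_scalar scaleNr => /eqP.
have bY : b *m Y^T = - x *: u^T by rewrite -[LHS]trmxK trmx_mul trmxK Yb linearZ.
have YY : Y *m Y^T = (s ^+ 2)%:M - u *m u^T by rewrite -h4 addrC addKr.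
rewrite linearD linearZ /= trmx_mul mulmxDl !mulmxDr -!scalemxAl -!scalemxAr.
rewrite [Y *m (b^T *m _)]mulmxA Yb -[u *m b *m Y^T]mulmxA bY.
rewrite -[u *m b *m _]mulmxA [b *m (b^T *m _)]mulmxA bb YY.
rewrite mul_scalar_mx -!scalemxAl -!scalemxAr !scalerA -!addrA -[RHS]addr0; congr (_ + _).
rewrite -scaleN1r -!scalerDl; set k := (X in X *: _).
suff -> : k = 0 by rewrite scale0r.
by rewrite /k; field; rewrite subr_eq0.
Qed.

Lemma expR_cosh_le (y : R) : y ^+ 2 <= 1 / 2 -> expR y + expR (- y) <= 2 * expR (2 * y ^+ 2).
Proof.
move=> y2.
have y1 : `|y| < 1 by rewrite -(ltr_pXn2r (n := 2)) ?nnegrE // real_normK ?num_real // expr1n; lra.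
have half (z : R) : `|z| < 1 -> expR z <= (1 - z)^-1.
  rewrite ltr_norml => /andP[z1 z2]; rewrite -[z in expR z]opprK expRN lef_pV2 ?posrE ?expR_gt0 //.
    exact: expR_ge1Dx.
  lra.
have h1 := half _ y1; have h2 := half (- y); rewrite normrN in h2; have {}h2 := h2 y1.
apply: le_trans (lerD h1 h2) _.
have h3 : 1 + 2 * y ^+ 2 <= expR (2 * y ^+ 2) by exact: expR_ge1Dx.
apply: (@le_trans _ _ (2 * (1 + 2 * y ^+ 2))); last by rewrite ler_pM2l.
move: y1; rewrite ltr_norml => /andP[z1 z2].
have -> : (1 - y)^-1 + (1 - - y)^-1 = 2 / (1 - y ^+ 2).
  by field; rewrite !gt_eqF //; nra.
rewrite ler_pdivrMr; nra.
Qed.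

(** The displacements p / (s - x) and p / (- s - x) differ by the sign of their main
part p s / (c - x^2), of size O(c^(-1/2)), and share the bias p x / (c - x^2), of
size O(1/c).  On average over the sign, the exponentials therefore grow by a
factor exp (O(l^2 / c)) instead of exp (O(l c^(-1/2))). *)
Lemma two_sign_average (l c D p x s : R)
    (f := fun t => expR (l * t) + expR (- (l * t))) : `|p| <= 4 -> `|x| <= 2 -> 8 <= c -> s ^+ 2 = c ->
  1 <= l -> 128 * l ^+ 2 <= c ->
  f (D + p / (s - x)) + f (D + p / (- s - x)) <= 2 * (expR (144 * l ^+ 2 / c) * f D).
Proof.
move=> hp hx c8 sc l1 lc.
have c0 : 0 < c by lra.
have hx2 : x ^+ 2 <= 4 by move: hx; rewrite ler_norml; nra.
have hp2 : p ^+ 2 <= 16 by move: hp; rewrite ler_norml; nra.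
pose w := c - x ^+ 2; have w2 : c / 2 <= w by rewrite /w; lra.
have w0 : 0 < w by apply: lt_le_trans w2; rewrite divr_gt0.
have sx : s - x != 0 by apply: contraL w0 => /eqP h; rewrite -leNgt /w -sc; nra.
have sx' : - s - x != 0 by apply: contraL w0 => /eqP h; rewrite -leNgt /w -sc; nra.
pose b := l * (p * x / w); pose y := l * (p * s / w).
have E1 : l * (D + p / (s - x)) = l * D + b + y.
  rewrite /b /y /w -sc; field; rewrite sx; apply/andP; split=> //.
  by move: w0; rewrite /w -sc => /lt0r_neq0.
have E2 : l * (D + p / (- s - x)) = l * D + b - y.
  rewrite /b /y /w -sc; field; rewrite sx'; apply/andP; split=> //.
  by move: w0; rewrite /w -sc => /lt0r_neq0.
pose q := l ^+ 2 / c.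
have q0 : 0 <= q by rewrite divr_ge0 ?sqr_ge0 // ltW.
have qc : q * c = l ^+ 2 by rewrite /q mulfVK ?gt_eqF.
have hpx : `|p * x| <= 8 by rewrite normrM -[8]/(4 * 2)%:R natrM ler_pM.
have hb : `|b| <= 16 * q.
  rewrite /b normrM [`|l|]ger0_norm; last lra.
  rewrite normrM normfV [`|w|]gtr0_norm // mulrA ler_pdivrMr //.
  apply: (@le_trans _ _ (l * 8)); first by rewrite ler_wpM2l //; lra.
  have : 16 * q * (c / 2) <= 16 * q * w by rewrite ler_wpM2l // mulr_ge0.
  apply: le_trans; have -> : 16 * q * (c / 2) = 8 * l ^+ 2 by rewrite -qc; field.
  by nra.
have hy : y ^+ 2 <= 64 * q.
  rewrite /y !exprMn exprVn mulrA ler_pdivrMr ?exprn_gt0 // sc.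
  have h1 : 16 * (64 * q * (c / 2) ^+ 2) <= 16 * (64 * q * w ^+ 2).
    rewrite ler_pM2l //; apply: ler_wpM2l; first by rewrite mulr_ge0.
    by apply: lerXn2r; rewrite ?nnegrE ?divr_ge0 // ltW.
  have h2 : 64 * q * (c / 2) ^+ 2 = 16 * l ^+ 2 * c by rewrite -qc; field.
  have h3 : l ^+ 2 * (p ^+ 2 * c) <= l ^+ 2 * (16 * c).
    by rewrite ler_wpM2l ?sqr_ge0 // ler_pM2r.
  by nra.
have y2 : y ^+ 2 <= 1 / 2.
  apply: le_trans hy _; suff : 128 * q <= 1 by lra.
  by rewrite /q mulrA ler_pdivrMr // mul1r.
have key (a b' y' : R) : b' <= 16 * q -> y' ^+ 2 = y ^+ 2 ->
    expR (a + b' + y') + expR (a + b' - y') <= 2 * (expR (144 * q) * expR a).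
  move=> hb' hy'; rewrite !(expRD (a + b')) -mulrDr expRD.
  have c1 := expR_cosh_le (_ : y' ^+ 2 <= 1 / 2); rewrite hy' in c1; have {}c1 := c1 y2.
  have h1 : expR b' <= expR (16 * q) by rewrite ler_expR.
  have h2 : expR (2 * y ^+ 2) <= expR (128 * q) by rewrite ler_expR; lra.
  have -> : 144 * q = 16 * q + 128 * q by lra.
  rewrite expRD [leRHS](_ : _ = expR a * expR (16 * q) * (2 * expR (128 * q))); last by ring.
  rewrite ler_pM ?mulr_ge0 ?addr_ge0 ?expR_ge0 //; first by rewrite ler_pM2l ?expR_gt0.
  by apply: le_trans c1 _; rewrite ler_pM2l.
have k1 := key (l * D) b y; have k2 := key (- (l * D)) (- b) (- y).
rewrite /f E1 E2 -/q -[144 * _ / _]mulrA -/q.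
rewrite !opprD opprK in k2 *.
have {}k1 := k1 (le_trans (ler_norm _) hb) erefl.
have {}k2 := k2 (le_trans (ler_norm _) (eq_ind_r (fun z => z <= _) hb (normrN b))) (sqrrN _).
by move: k1 k2; rewrite mulrDr; lra.
Qed.

Definition cosh_sum (l : R) m n (D : 'M[R]_(m, n)) :=
  \sum_i \sum_j (expR (l * D i j) + expR (- (l * D i j))).

Lemma cosh_ge0 (x : R) : 0 <= expR x + expR (- x).
Proof. by rewrite addr_ge0 ?expR_ge0. Qed.

Lemma cosh_sum_drsub l m n (D : 'M[R]_(1 + m, 1 + n)) :
  cosh_sum l (drsubmx D) <= cosh_sum l D.
Proof.
rewrite /cosh_sum [leRHS]big_split_ord /=.
have s0 i : 0 <= \sum_j (expR (l * D i j) + expR (- (l * D i j))).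
  by apply: sumr_ge0 => j _; exact: cosh_ge0.
apply: le_trans (_ : _ <= \sum_(i < m) \sum_j (expR (l * D (rshift 1 i) j)
    + expR (- (l * D (rshift 1 i) j)))) _; last by rewrite lerDr sumr_ge0.
apply: ler_sum => i _; rewrite [leRHS]big_split_ord /=.
under eq_bigr => j _ do rewrite !mxE.
by rewrite lerDr sumr_ge0 // => j _; exact: cosh_ge0.
Qed.

Lemma cosh_sum_entry l m n (D : 'M[R]_(m, n)) i j : expR (l * `|D i j|) <= cosh_sum l D.
Proof.
rewrite /cosh_sum (bigD1 i) //= (bigD1 j) //= -addrA.
apply: (@le_trans _ _ (expR (l * D i j) + expR (- (l * D i j)))).
  by case: (ger0P (D i j)) => _; rewrite ?mulrN ?lerDl ?lerDr expR_ge0.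
rewrite lerDl addr_ge0 // sumr_ge0 // => *; last apply: sumr_ge0 => *; exact: cosh_ge0.
Qed.

(** One of the two choices of the sign increases the potential by no more than the
average factor.  Along the walk, the bound 2 on the entries follows from the
bound on the potential. *)
Lemma removal_step l c m (X H : 'M[R]_(1 + m)) : X *m X^T = c%:M ->
    (forall i j, `|X i j| <= 2) -> 8 <= c -> 1 <= l -> 128 * l ^+ 2 <= c ->
  exists2 X' : 'M[R]_m, X' *m X'^T = c%:M &
    cosh_sum l (X' - drsubmx H) <= expR (144 * l ^+ 2 / c) * cosh_sum l (X - H).
Proof.
move=> XX X2 c8 l1 lc; pose s := Num.sqrt c.
have ss : s ^+ 2 = c by rewrite sqr_sqrtr //; lra.
have x2 : X 0 0 ^+ 2 <= 4 by have := X2 0 0; rewrite ler_norml; nra.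
have neq (t : R) : t ^+ 2 = c -> t != X 0 0.
  by move=> tc; apply/eqP => tx; move: x2; rewrite -tx tc; lra.
have tot : cosh_sum l (compress X s - drsubmx H) + cosh_sum l (compress X (- s) - drsubmx H)
    <= 2 * (expR (144 * l ^+ 2 / c) * cosh_sum l (X - H)).
  apply: (@le_trans _ _ (2 * (expR (144 * l ^+ 2 / c) * cosh_sum l (drsubmx (X - H))))); last first.
    by rewrite ler_pM2l // ler_pM2l ?expR_gt0 // cosh_sum_drsub.
  rewrite /cosh_sum -big_split /= !mulr_sumr; apply: ler_sum => i _.
  rewrite -big_split /= !mulr_sumr; apply: ler_sum => j _.
  have E t : (compress X t - drsubmx H) i j = (drsubmx (X - H)) i j
     + X (rshift 1 i) 0 * X 0 (rshift 1 j) / (t - X 0 0).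
    by rewrite mxE compressE !mxE; ring.
  rewrite !E; apply: two_sign_average => //.
  by rewrite normrM -[4]/((2 * 2)%:R) natrM ler_pM.
have [h|h] := lerP (cosh_sum l (compress X s - drsubmx H))
  (expR (144 * l ^+ 2 / c) * cosh_sum l (X - H)).
  by exists (compress X s) => //; rewrite -ss; apply: compress_orthogonal; rewrite ?ss ?neq.
exists (compress X (- s)); last by lra.
by rewrite -ss -sqrrN; apply: compress_orthogonal; rewrite ?sqrrN ?ss ?neq // sqrrN.
Qed.

Lemma removal_walk l c r m (X H : 'M[R]_(r + m)) B : X *m X^T = c%:M ->
    sign_mx H -> 8 <= c -> 1 <= l -> 128 * l ^+ 2 <= c ->
    cosh_sum l (X - H) <= B -> expR (144 * l ^+ 2 / c) ^+ r * B <= expR l ->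
  exists X' H' : 'M[R]_m, [/\ X' *m X'^T = c%:M, sign_mx H' &
    cosh_sum l (X' - H') <= expR (144 * l ^+ 2 / c) ^+ r * B].
Proof.
move=> + + c8 l1 lc; elim: r X H B => [|r IH] X H B XX sH XB Bl.
  by exists X, H; split => //; rewrite expr0 mul1r.
have e1 : 1 <= expR (144 * l ^+ 2 / c).
  rewrite -expR0 ler_expR divr_ge0 // ?mulr_ge0 ?sqr_ge0 //; lra.
have B0 : 0 <= B.
  by apply: le_trans XB; rewrite sumr_ge0 // => i _; rewrite sumr_ge0 // => j _; exact: cosh_ge0.
have X2 i j : `|X i j| <= 2.
  have h : `|(X - H) i j| <= 1.
    have l0 : 0 < l by lra.
    rewrite -(ler_pM2l l0) mulr1 -ler_expR.
    apply: le_trans (cosh_sum_entry l (X - H) i j) _; apply: le_trans XB _.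
    by apply: le_trans Bl; rewrite -[leLHS]mul1r ler_wpM2r // exprn_ege1.
  have nH : `|H i j| = 1 by case: (sH i j) => ->; rewrite ?normrN normr1.
  have := ler_normD (H i j) (X i j - H i j); rewrite addrC subrK nH.
  by move: h; rewrite !mxE; lra.
have [X' XX' hX'] := @removal_step l c (r + m) X H XX X2 c8 l1 lc.
have sH' : sign_mx (drsubmx (H : 'M[R]_(1 + (r + m)))) by move=> i j; rewrite !mxE; exact: sH.
have h1 : cosh_sum l (X' - drsubmx (H : 'M[R]_(1 + (r + m)))) <= expR (144 * l ^+ 2 / c) * B.
  by apply: le_trans hX' _; rewrite ler_pM2l ?expR_gt0.
by have := IH X' _ _ XX' sH' h1; rewrite mulrA -exprSr; apply.
Qed.

(** The potential starts at 2 N^2 and bounds each exp (l |D_ij|), so it controls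
the largest deviation from the original signs after r steps. *)
Lemma near_sign_orthogonal l t r n : has_hadamard R (r + n) -> (8 <= r + n)%N ->
    1 <= l -> 128 * l ^+ 2 <= (r + n)%:R -> t <= 1 ->
    2 * (r + n)%:R ^+ 2 * expR (144 * l ^+ 2 * r%:R / (r + n)%:R) <= expR (l * t) ->
  exists2 X : 'M[R]_n, X *m X^T = (r + n)%:R%:M & forall i j, 1 - t <= `|X i j| <= 1 + t.
Proof.
move=> [H sH HH] N8 l1 lc t1 hB; set N := (r + n)%:R in HH lc hB *.
pose B : R := 2 * N ^+ 2.
have start : cosh_sum l (H - H) <= B.
  rewrite subrr /cosh_sum; under eq_bigr => i _ do under eq_bigr => j _ do
    rewrite mxE mulr0 oppr0 expR0.
  by rewrite !sumr_const card_ord -mulrnA -[(1 + 1) *+ _]mulr_natr natrM -/N /B expr2.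
have E : expR (144 * l ^+ 2 / N) ^+ r * B = 2 * N ^+ 2 * expR (144 * l ^+ 2 * r%:R / N).
  by rewrite -expRM_natr /B mulrC; congr (_ * expR _); rewrite mulrAC.
have lt : l * t <= l by rewrite -[leRHS]mulr1 ler_wpM2l //; lra.
have [||X' [H' [XX' sH' hX']]] := removal_walk HH sH _ l1 lc start.
- by rewrite (ler_nat _ 8).
- by rewrite E; apply: le_trans hB _; rewrite ler_expR.
exists X' => // i j.
have := le_trans (cosh_sum_entry l (X' - H') i j) hX'; rewrite E => /le_trans /(_ hB).
rewrite ler_expR ler_pM2l; last by lra.
rewrite !mxE; case: (sH' i j) => ->; rewrite ?opprK => h.
  have := ler_normB (X' i j) (X' i j - 1); rewrite opprB addrC subrK normr1.
  have := ler_normD (X' i j - 1) 1; rewrite subrK normr1; lra.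
have := ler_normB (X' i j) (X' i j + 1).
rewrite opprD addNKr normrN1.
have := ler_normD (X' i j + 1) (- 1); rewrite addrK normrN1; lra.
Qed.
End Removal.

(** * Rounding to signs with small operator norm *)

Section Rounding.
Variable R : realFieldType.

Definition qform n (P : 'M[R]_n) (x : 'rV[R]_n) : R := (x *m P *m x^T) 0 0.

Lemma qformE n (P : 'M[R]_n) x : x *m P *m x^T = (qform P x)%:M.
Proof. exact: mx11_scalar. Qed.

Lemma qformD n (P Q : 'M[R]_n) x : qform (P + Q) x = qform P x + qform Q x.
Proof. by rewrite /qform mulmxDr mulmxDl mxE. Qed.

Lemma qformZ n a (P : 'M[R]_n) x : qform (a *: P) x = a * qform P x.
Proof. by rewrite /qform -scalemxAr -scalemxAl mxE. Qed.

Lemma qformN n (P : 'M[R]_n) x : qform (- P) x = - qform P x.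
Proof. by rewrite -scaleN1r qformZ mulN1r. Qed.

Lemma qform_delta n (P : 'M[R]_n) i : qform P (delta_mx 0 i) = P i i.
Proof. by rewrite /qform -rowE trmx_delta -colE !mxE. Qed.

Lemma qform_conj n m (B : 'M[R]_(n, m)) (P : 'M[R]_m) x :
  qform (B *m P *m B^T) x = qform P (x *m B).
Proof. by rewrite /qform trmx_mul !mulmxA. Qed.

Lemma qform1 n (x : 'rV[R]_n) : qform 1%:M x = \sum_j x 0 j ^+ 2.
Proof. by rewrite /qform mulmx1 mxE; apply: eq_bigr => j _; rewrite mxE expr2. Qed.

Lemma qform1_gt0 n (x : 'rV[R]_n) : x != 0 -> 0 < qform 1%:M x.
Proof.
move=> /rV0Pn[j xj]; rewrite qform1 (bigD1 j) //=.
by rewrite ltr_pwDl ?sumr_ge0 // ?exprn_even_gt0 // => i _; rewrite sqr_ge0.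
Qed.

Lemma qform1_ge0 n (x : 'rV[R]_n) : 0 <= qform 1%:M x.
Proof. by rewrite qform1 sumr_ge0 // => i _; rewrite sqr_ge0. Qed.

(** For independent random signs a_j of mean f_j, the right-hand side is the
expectation of the quadratic form at a - f.  The method of conditional
expectations fixes the coordinates one at a time: [d] below is a - f on the fixed
coordinates and 0 elsewhere. *)
Lemma row_rounding n (G : 'M[R]_n) (f : 'rV[R]_n) : (forall j, -1 <= f 0 j <= 1) ->
  exists2 a : 'rV[R]_n, sign_mx a & qform G (a - f) <= \sum_j G j j * (1 - f 0 j ^+ 2).
Proof.
move=> f1.
suff [d [d1 _ d2]] : exists d : 'rV[R]_n,
    [/\ forall j, j \in enum 'I_n -> d 0 j + f 0 j = 1 \/ d 0 j + f 0 j = -1,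
        forall j, j \notin enum 'I_n -> d 0 j = 0 &
        qform G d <= \sum_(j <- enum 'I_n) G j j * (1 - f 0 j ^+ 2)].
  exists (d + f) => [i j|]; first by rewrite ord1 mxE; apply: d1; rewrite mem_enum.
  by rewrite addrK; move: d2; rewrite big_enum.
elim: (enum 'I_n) (enum_uniq 'I_n) => [_|j l IH /= /andP[jl ul]].
  by exists 0; split => // [j _|]; rewrite ?mxE // big_nil /qform !mul0mx mxE.
have [d [d1 d0 d2]] := IH ul.
pose b := (d *m G) 0 j + (G *m d^T) j 0.
have qd t : qform G (d + t *: delta_mx 0 j) = qform G d + t * b + t ^+ 2 * G j j.
  rewrite /qform linearD /= linearZ /= mulmxDl !mulmxDr mulmxDl -!scalemxAl -!scalemxAr.
  rewrite mulmxDl -!scalemxAl -(mulmxA _ G d^T) trmx_delta -!colE -!rowE.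
  rewrite /b -row_mul; move: (d *m (G *m d^T)) (G *m d^T) (d *m G) => u1 u2 u3.
  by rewrite !mxE; ring.
have [t tf ht] : exists2 t, (t + f 0 j = 1 \/ t + f 0 j = -1) &
    t * b + t ^+ 2 * G j j <= G j j * (1 - f 0 j ^+ 2).
  pose e t := t * b + t ^+ 2 * G j j; set g := G j j * _.
  (* The two choices, weighted by the law of mean f_j, average to g. *)
  have avg : (1 + f 0 j) * (e (1 - f 0 j) - g) + (1 - f 0 j) * (e (-1 - f 0 j) - g) = 0.
    by rewrite /e /g; ring.
  have [h1|h1] := lerP (e (1 - f 0 j)) g.
    by exists (1 - f 0 j) => //; left; rewrite subrK.
  have [h2|h2] := lerP (e (-1 - f 0 j)) g.
    by exists (-1 - f 0 j) => //; right; rewrite subrK.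
  have /andP[f_ge f_le] := f1 j.
  have p1 : 0 <= (1 + f 0 j) * (e (1 - f 0 j) - g) by apply: mulr_ge0; lra.
  have p2 : 0 <= (1 - f 0 j) * (e (-1 - f 0 j) - g) by apply: mulr_ge0; lra.
  have /eqP : (1 + f 0 j) * (e (1 - f 0 j) - g) = 0 by lra.
  rewrite mulf_eq0 => /orP[]/eqP z1; last by lra.
  have /eqP : (1 - f 0 j) * (e (-1 - f 0 j) - g) = 0 by lra.
  by rewrite mulf_eq0 => /orP[]/eqP z2; lra.
exists (d + t *: delta_mx 0 j); split.
- move=> i; rewrite inE !mxE eqxx /=; case: eqVneq => [->|ij] /=.
    by rewrite mulr1 d0 // add0r.
  by rewrite mulr0 addr0; exact: d1.
- move=> i; rewrite inE negb_or !mxE eqxx /= => /andP[/negPf -> il].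
  by rewrite mulr0 addr0 d0.
- by rewrite qd big_cons -addrA addrC lerD.
Qed.

Definition posdef n (P : 'M[R]_n) := P^T = P /\ forall x, x != 0 -> 0 < qform P x.

Section Posdef.
Variables (n : nat) (P : 'M[R]_n).
Hypothesis Pp : posdef P.

Lemma posdef_ge0 x : 0 <= qform P x.
Proof.
have [->|x0] := eqVneq x 0; first by rewrite /qform !mul0mx mxE.
by rewrite ltW // Pp.2.
Qed.

Lemma posdef_unit : P \in unitmx.
Proof.
rewrite -row_free_unit -kermx_eq0; apply/rowV0P => v /sub_kermxP vP.
by apply/eqP; apply: contraT => /(Pp.2); rewrite /qform vP mul0mx mxE ltxx.
Qed.

Lemma posdef_inv : posdef (invmx P).
Proof.
have PU := posdef_unit; split; first by rewrite trmx_inv Pp.1.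
move=> x x0; have -> : qform (invmx P) x = qform P (x *m invmx P).
  by rewrite -qform_conj trmx_inv Pp.1 mulVmx // mul1mx.
apply: Pp.2; apply: contra_neq x0 => /(congr1 (mulmx^~ P)).
by rewrite mulmxKV // mul0mx.
Qed.

Lemma posdef_sqr : posdef (P *m P).
Proof.
split; first by rewrite trmx_mul Pp.1.
move=> x x0; have -> : qform (P *m P) x = qform 1%:M (x *m P).
  by rewrite -qform_conj mulmx1 Pp.1.
apply: qform1_gt0; apply: contra_neq x0 => /(congr1 (mulmx^~ (invmx P))).
by rewrite mulmxK ?posdef_unit // mul0mx.
Qed.

Lemma posdef_trace_gt0 : (0 < n)%N -> 0 < \tr P.
Proof.
case: n P Pp => // m Q Qp _; rewrite /mxtrace (bigD1 0) //=.
have d0 i : 0 < Q i i.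
  rewrite -qform_delta; apply: Qp.2; apply/rV0Pn; exists i.
  by rewrite mxE !eqxx oner_eq0.
by rewrite ltr_pwDl // sumr_ge0 // => i _; rewrite ltW.
Qed.

Lemma posdef_shift d : 0 <= d -> posdef (P + d%:M).
Proof.
move=> d0; split; first by rewrite linearD /= tr_scalar_mx Pp.1.
move=> x x0; rewrite qformD -scalemx1 qformZ ltr_pwDl ?Pp.2 //.
by rewrite mulr_ge0 // qform1_ge0.
Qed.

Lemma trace_conj_ge0 (B : 'M[R]_n) : 0 <= \tr (B *m P *m B^T).
Proof.
by apply: sumr_ge0 => i _; rewrite -qform_delta qform_conj posdef_ge0.
Qed.

End Posdef.

(** Discrete form of d/du tr (u - M)^-1 = - tr (u - M)^-2: with W the inverse of P,
the resolvent identity gives tr W - tr W' = d tr (W W'), and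
tr (W W') >= tr (W' W') because W - W' = d W W' with W positive. *)
Lemma trace_inv_shift n (P : 'M[R]_n) d (W' := invmx (P + d%:M)) : posdef P -> 0 <= d ->
  \tr W' + d * \tr (W' *m W') <= \tr (invmx P).
Proof.
move=> Pp d0; have P'p := posdef_shift Pp d0; have Wp := posdef_inv Pp.
have PU := posdef_unit Pp; have P'U := posdef_unit P'p.
have W'T : W'^T = W' by case: (posdef_inv P'p).
set W := invmx P in Wp *.
have WW' : W = W' + d *: (W *m W').
  rewrite -mul_scalar_mx mulmxA -[X in _ + X *m _]scalar_mxC -mulmxA.
  have -> : d%:M = (P + d%:M) - P by rewrite addrC addKr.
  have PW' : (P + d%:M) *m W' = 1%:M by rewrite mulmxV.
  have WP : W *m P = 1%:M by rewrite mulVmx.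
  by rewrite mulmxBl PW' mulmxBr mulmx1 mulmxA WP mul1mx addrC subrK.
rewrite [leRHS](congr1 mxtrace WW') mxtraceD mxtraceZ lerD2l ler_wpM2l //.
rewrite {1}WW' mulmxDl mxtraceD lerDl -scalemxAl mxtraceZ mulr_ge0 //.
by rewrite mxtrace_mulC mulmxA -{2}W'T; exact: trace_conj_ge0.
Qed.

Lemma sherman_morrison n (P : 'M[R]_n) (v : 'rV[R]_n) (W := invmx P) : posdef P ->
    qform W v <= 1 / 2 ->
  posdef (P - v^T *m v) /\
  \tr (invmx (P - v^T *m v)) <= \tr W + 2 * qform (W *m W) v.
Proof.
move=> Pp q2; have PU := posdef_unit Pp; have [WT _] := posdef_inv Pp; rewrite -/W in WT.
set Q := P - _.
have Qp : posdef Q.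
  split; first by rewrite linearB /= trmx_mul trmxK Pp.1.
  move=> x x0; rewrite qformD qformN.
  pose c := (x *m v^T) 0 0.
  have -> : qform (v^T *m v) x = c ^+ 2.
    rewrite /qform mulmxA -mulmxA (_ : v *m x^T = (x *m v^T)^T); last by rewrite trmx_mul trmxK.
    by rewrite (mx11_scalar (x *m v^T)) -/c tr_scalar_mx -scalar_mxM mxE eqxx -expr2.
  (* Cauchy-Schwarz for P: with qform W v <= 1/2, this gives 2 c^2 <= qform P x. *)
  have := posdef_ge0 Pp (x - (2 * c) *: (v *m W)).
  have -> : qform P (x - (2 * c) *: (v *m W)) = qform P x - 4 * c ^+ 2 + 4 * c ^+ 2 * qform W v.
    have tr : (x - (2 * c) *: (v *m W))^T = x^T - (2 * c) *: (W *m v^T).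
      by rewrite -{2}WT -trmx_mul; apply/matrixP => i j; rewrite !mxE.
    have e1 : (x - (2 * c) *: (v *m W)) *m P = x *m P - (2 * c) *: v.
      by rewrite mulmxBl -scalemxAl -(mulmxA v) mulVmx // mulmx1.
    have e2 : x *m P *m (W *m v^T) = x *m v^T.
      by rewrite mulmxA -(mulmxA x) mulmxV // mulmx1.
    have e3 : v *m x^T = (x *m v^T)^T by rewrite trmx_mul trmxK.
    rewrite /qform tr e1 mulmxBl !mulmxBr -!scalemxAr -!scalemxAl e2 e3.
    rewrite (mulmxA v W) /c; move: (x *m P *m x^T) (x *m v^T) (v *m W *m v^T) => a b d.
    by rewrite !mxE; ring.
  have := Pp.2 x x0; have := posdef_ge0 (posdef_inv Pp) v; rewrite -/W.
  have := sqr_ge0 c; nra.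
split=> //; have QU := posdef_unit Qp.
set q := qform W v in q2.
have q1 : 1 - q != 0 by apply: lt0r_neq0; lra.
have -> : invmx Q = W + (1 - q)^-1 *: (W *m v^T *m (v *m W)).
  apply: (can_inj (mulKmx QU)); rewrite mulmxV //.
  rewrite mulmxDr -scalemxAr !mulmxBl mulmxV // !mulmxA mulmxV // mul1mx.
  rewrite -(mulmxA v^T v W) -(mulmxA v^T (v *m W)) qformE -/q.
  rewrite mul_mx_scalar -!scalemxAl -mulmxA.
  set S := v^T *m (v *m W).
  have -> : S - q *: S = (1 - q) *: S by rewrite scalerBl scale1r.
  by rewrite scalerA mulVf // scale1r subrK.
rewrite mxtraceD lerD2l mxtraceZ mxtrace_mulC mulmxA -(mulmxA v W W) qformE.
rewrite (mxtrace_scalar) mulr1n.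
rewrite ler_wpM2r ?posdef_ge0 //; first exact: posdef_sqr (posdef_inv Pp).
rewrite -[2]invrK lef_pV2 ?posrE ?invr_gt0 //; lra.
Qed.

(** The shift of the barrier by 4 e lowers the trace of the inverse by at least
4 e tr W^2, where W is the inverse after the shift.  A typical row v = a - f has
qform W v <= e tr W and qform (W^2) v <= e tr W^2, so the rank-one update gives
back at most as much, by the Sherman-Morrison formula.  Both estimates are needed for
the same row, at the cost of a factor 2: [row_rounding] is applied to the
combination of W and W^2 normalized by their traces. *)
Lemma barrier_step n (P : 'M[R]_n) (f : 'rV[R]_n) e : (0 < n)%N -> 0 < e ->
    posdef P -> 4 * e * \tr (invmx P) <= 1 ->
    (forall j, -1 <= f 0 j <= 1) -> (forall j, 1 - f 0 j ^+ 2 <= e) ->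
  exists2 a : 'rV[R]_n, sign_mx a &
    posdef (P + (4 * e)%:M - (a - f)^T *m (a - f)) /\
    4 * e * \tr (invmx (P + (4 * e)%:M - (a - f)^T *m (a - f))) <= 1.
Proof.
move=> n0 e0 Pp trP f1 fe; have d0 : 0 <= 4 * e by lra.
have P'p := posdef_shift Pp d0; have Wp := posdef_inv P'p; have W2p := posdef_sqr Wp.
have tr1 := trace_inv_shift Pp d0.
set P' := P + _ in P'p Wp W2p tr1 *; set W := invmx P' in Wp W2p tr1 *.
have t1 := posdef_trace_gt0 Wp n0; have t2 := posdef_trace_gt0 W2p n0.
set T1 := \tr W in t1 tr1; set T2 := \tr (W *m W) in t2 tr1.
have [a sa ha] := row_rounding (T2 *: W + T1 *: (W *m W)) f1.
exists a => //; set v := a - f in ha *.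
have {}ha : T2 * qform W v + T1 * qform (W *m W) v <= e * (2 * T1 * T2).
  rewrite -!qformZ -qformD; apply: le_trans ha _.
  have -> : e * (2 * T1 * T2) = e * \tr (T2 *: W + T1 *: (W *m W)).
    by rewrite mxtraceD !mxtraceZ -/T1 -/T2; ring.
  rewrite mulr_sumr; apply: ler_sum => j _; rewrite mulrC ler_wpM2r //.
  by rewrite -qform_delta qformD !qformZ addr_ge0 // mulr_ge0 ?posdef_ge0 // ltW.
have q1 := posdef_ge0 Wp v; have q2 := posdef_ge0 W2p v.
have h1 : qform W v <= 2 * e * T1.
  rewrite -(ler_pM2l t2); apply: le_trans (_ : _ <= e * (2 * T1 * T2)) _; last by lra.
  by apply: le_trans ha; rewrite lerDl mulr_ge0 // ltW.
have h2 : qform (W *m W) v <= 2 * e * T2.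
  rewrite -(ler_pM2l t1); apply: le_trans (_ : _ <= e * (2 * T1 * T2)) _; last by lra.
  by apply: le_trans ha; rewrite lerDr mulr_ge0 // ltW.
have h3 : qform W v <= 1 / 2 by nra.
have [Qp trQ] := sherman_morrison P'p h3; split=> //.
by apply: le_trans trP; rewrite ler_pM2l //; [lra|lra].
Qed.

(** The initial barrier 4 e n makes the trace of the inverse 1 / (4 e), the largest
value for which a step is possible. *)
Lemma barrier n k (F : 'M[R]_(k, n)) e : (0 < n)%N -> 0 < e ->
    (forall i j, -1 <= F i j <= 1) -> (forall i j, 1 - F i j ^+ 2 <= e) ->
  exists2 A : 'M[R]_(k, n), sign_mx A &
    let Q := (4 * e * (n + k)%:R)%:M - (A - F)^T *m (A - F) in
    posdef Q /\ 4 * e * \tr (invmx Q) <= 1.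
Proof.
move=> n0 e0; elim: k F => [|k IH] F F1 Fe.
  exists 0; first by case.
  have c0 : 0 < 4 * e * (n + 0)%:R by rewrite addn0 !mulr_gt0 // ltr0n.
  rewrite /= (flatmx0 (0 - F)) mulmx0 subr0; split.
    split; first exact: tr_scalar_mx.
    by move=> x x0; rewrite -scalemx1 qformZ mulr_gt0 // qform1_gt0.
  rewrite invmx_scalar mxtrace_scalar addn0 -mulr_natr.
  have nn0 : n%:R != 0 :> R by rewrite pnatr_eq0 -lt0n.
  by rewrite [leLHS](_ : _ = 1) //; field; rewrite nn0 gt_eqF.
have := F1; have := Fe; rewrite -(@vsubmxK R 1 k n F).
move: (usubmx _) (dsubmx _) => f G Fe' F1'.
have [||A sA [Qp trQ]] := IH G.
- by move=> i j; rewrite -(col_mxEd f G); exact: F1'.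
- by move=> i j; rewrite -(col_mxEd f G); exact: Fe'.
have [||a sa] := barrier_step n0 e0 Qp trQ (f := f).
- by move=> j; rewrite -(col_mxEu f G); exact: F1'.
- by move=> j; rewrite -(col_mxEu f G); exact: Fe'.
move=> h; exists (col_mx a A).
  move=> i j; case: (@split_ordP 1 k i) => i' ->.
    by have := sa i' j; rewrite -(col_mxEu a A).
  by have := sA i' j; rewrite -(col_mxEd a A).
move: h; set Q := _ - _ in Qp *; set Q' := _ - _; set Q2 := (X in let Q := X in _).
suff -> : Q' = Q2 by [].
have E : col_mx a A - col_mx f G = col_mx (a - f) (A - G) by rewrite opp_col_mx add_col_mx.
have -> : Q2 = (4 * e * (n + k.+1)%:R)%:M - (col_mx (a - f) (A - G))^T *m col_mx (a - f) (A - G).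
  by rewrite -E.
rewrite /Q' /Q tr_col_mx mul_row_col addnS -(natr1 (n + k)%N) mulrDr mulr1 (raddfD (@scalar_mx R n)) /= opprD !addrA.
by rewrite [RHS]addrAC; congr (_ - _); rewrite addrAC.
Qed.

Lemma sign_rounding n (F : 'M[R]_n) e : 0 < e ->
    (forall i j, -1 <= F i j <= 1) -> (forall i j, 1 - F i j ^+ 2 <= e) ->
  exists2 A : 'M[R]_n, sign_mx A &
    forall x, qform ((A - F)^T *m (A - F)) x <= 8 * e * n%:R * qform 1%:M x.
Proof.
move=> e0 F1 Fe; case: n F F1 Fe => [|n] F F1 Fe.
  exists 0; first by case.
  by move=> x; rewrite (thinmx0 x) /qform !mul0mx mxE mulr0.
have [A sA [/posdef_ge0 Qp _]] := barrier (isT : (0 < n.+1)%N) e0 F1 Fe.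
exists A => // x; have := Qp x; rewrite qformD qformN -scalemx1 qformZ subr_ge0.
by move/le_trans; apply; rewrite natrD; lra.
Qed.
End Rounding.

(** * Condition number of a nearly orthogonal matrix *)

Section Condition.
Variable R : realType.

Definition dot n (x y : 'rV[R]_n) : R := (x *m y^T) 0 0.

Lemma dotC n (x y : 'rV[R]_n) : dot x y = dot y x.
Proof. by rewrite /dot -[x in LHS]trmxK -trmx_mul mxE. Qed.

Lemma dotDl n (x y z : 'rV[R]_n) : dot (x + y) z = dot x z + dot y z.
Proof. by rewrite /dot mulmxDl mxE. Qed.

Lemma dotZl n a (x y : 'rV[R]_n) : dot (a *: x) y = a * dot x y.
Proof. by rewrite /dot -scalemxAl mxE. Qed.

Lemma dotE n (x : 'rV[R]_n) : dot x x = qform 1%:M x.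
Proof. by rewrite /qform mulmx1. Qed.

(** A complex eigenvector a + i b with eigenvalue al + i be satisfies
be (|a|^2 + |b|^2) = 0 by symmetry, so the real or the imaginary part is a real
eigenvector. *)
Lemma real_eigenvalue_symmetric n (S : 'M[R]_n) : (0 < n)%N -> S^T = S ->
  exists2 v : 'rV[R]_n, v != 0 & exists a, v *m S = a *: v.
Proof.
case: n S => // n S _ ST.
pose toC : R -> R[i] := real_complex R.
have [z] : exists z, root (char_poly (map_mx toC S)) z.
  by apply/closed_rootP; rewrite size_char_poly.
rewrite -eigenvalue_root_char => /eigenvalueP[w wS w0].
pose a : 'rV[R]_n.+1 := \row_j complex.Re (w 0 j).
pose b : 'rV[R]_n.+1 := \row_j complex.Im (w 0 j).
case: z wS => al be wS.
have ReD : {morph (@complex.Re R) : x y / x + y} by case=> ? ? [].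
have ImD : {morph (@complex.Im R) : x y / x + y} by case=> ? ? [].
have aS : a *m S = al *: a - be *: b.
  apply/rowP => j; have := congr1 (fun M : 'rV[R[i]]_n.+1 => complex.Re (M 0 j)) wS.
  rewrite !mxE (big_morph _ ReD (erefl : complex.Re 0 = 0)) => h.
  transitivity (\sum_i complex.Re (w 0 i * (map_mx toC S) i j)).
    by apply: eq_bigr => k _; rewrite !mxE; case: (w 0 k) => x y /=; ring.
  by rewrite h; case: (w 0 j).
have bS : b *m S = al *: b + be *: a.
  apply/rowP => j; have := congr1 (fun M : 'rV[R[i]]_n.+1 => complex.Im (M 0 j)) wS.
  rewrite !mxE (big_morph _ ImD (erefl : complex.Im 0 = 0)) => h.
  transitivity (\sum_i complex.Im (w 0 i * (map_mx toC S) i j)).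
    by apply: eq_bigr => k _; rewrite !mxE; case: (w 0 k) => x y /=; ring.
  by rewrite h; case: (w 0 j) => x y /=.
have ab : (a != 0) || (b != 0).
  rewrite -negb_and; apply: contra w0 => /andP[/eqP a0 /eqP b0]; apply/eqP/rowP => j.
  have := congr1 (fun M : 'rV[R]_n.+1 => M 0 j) a0; have := congr1 (fun M : 'rV[R]_n.+1 => M 0 j) b0.
  by rewrite !mxE; case: (w 0 j) => x y /= -> ->.
have be0 : be = 0.
  have sym : dot (a *m S) b = dot (b *m S) a.
    by rewrite [RHS]dotC /dot trmx_mul ST mulmxA.
  have : be * (qform 1%:M a + qform 1%:M b) = 0.
    move: sym; rewrite aS bS -scaleN1r !dotDl !dotZl (dotC b a) -!dotE => h; lra.
  move/eqP; rewrite mulf_eq0 => /orP[/eqP //|]; rewrite gt_eqF //.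
  have := qform1_ge0 a; have := qform1_ge0 b.
  by case/orP: ab => /qform1_gt0; lra.
case/orP: ab => [a0|b0]; [exists a => //|exists b => //]; exists al.
  by rewrite aS be0 scale0r subr0.
by rewrite bS be0 scale0r addr0.
Qed.

(** Without this, the infimum defining the smallest singular value could be that
of the empty set, for which the condition number would be infinite. *)
Lemma singular_values_nonempty n (A : 'M[R]_n) : (0 < n)%N ->
  exists s, singular_values A s.
Proof.
move=> n0; have [|v v0 [a va]] := @real_eigenvalue_symmetric n (A^T *m A) n0.
  by rewrite trmx_mul trmxK.
have : 0 <= a.
  have h : qform (A^T *m A) v = a * qform 1%:M v.
    by rewrite /qform va mulmx1 -scalemxAl mxE.
  rewrite -(pmulr_lge0 _ (qform1_gt0 v0)) -h.
  by rewrite -[A^T]mulmx1 -{2}[A]trmxK qform_conj qform1_ge0.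
exists (Num.sqrt a); split; first exact: sqrtr_ge0.
by apply/eigenvalueP; exists v => //; rewrite sqr_sqrtr.
Qed.

(** Triangle inequality for squared norms in Young's form, which avoids square
roots; it loses nothing in the extreme case |z| = h |y|. *)
Lemma qform1_add_bounds n (y z : 'rV[R]_n) h : 0 < h -> h < 1 ->
  (1 - h) * qform 1%:M y - (h^-1 - 1) * qform 1%:M z <= qform 1%:M (y + z)
   <= (1 + h) * qform 1%:M y + (1 + h^-1) * qform 1%:M z.
Proof.
move=> h0 h1; have p := qform1_ge0 (h *: y + 1 *: z); have m := qform1_ge0 (h *: y + (-1) *: z).
move: p m; rewrite -!dotE.
have E c d (u w : 'rV[R]_n) : dot (c *: u + d *: w) (c *: u + d *: w) =
    c ^+ 2 * dot u u + 2 * c * d * dot u w + d ^+ 2 * dot w w.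
  rewrite dotDl !dotZl (dotC u (_ + _)) (dotC w (_ + _)) !dotDl !dotZl (dotC w u); ring.
have -> : y + z = 1 *: y + 1 *: z by rewrite !scale1r.
rewrite !E.
move: (dot y y) (dot y z) (dot z z) => Y B Z p m.
have hB : - (h * Y + h^-1 * Z) <= 2 * B <= h * Y + h^-1 * Z.
  have -> : h * Y + h^-1 * Z = (h ^+ 2 * Y + Z) / h by field; rewrite gt_eqF.
  rewrite -mulNr ler_pdivrMr // ler_pdivlMr //; apply/andP; split; lra.
by move: hB => /andP[]; lra.
Qed.

Lemma cond_number_le n (A F : 'M[R]_n) d h : (0 < n)%N -> 0 < d -> 0 < h -> h < 1 ->
    F *m F^T = d%:M ->
    (forall x, qform ((A - F)^T *m (A - F)) x <= h ^+ 2 * d * qform 1%:M x) ->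
  (cond_number A <= ((1 + h) / (1 - h))%:E)%E.
Proof.
move=> n0 d0 h0 h1 FF hE.
have FF' : F^T *m F = d%:M.
  have dU : d != 0 by rewrite gt_eqF.
  have : F *m (d^-1 *: F^T) = 1%:M by rewrite -scalemxAr FF scale_scalar_mx mulVf.
  by move/mulmx1C; rewrite -scalemxAl => /(congr1 ( *:%R d)); rewrite scalerA mulfV // scale1r scalemx1.
pose q := Num.sqrt d.
have qq : q ^+ 2 = d by rewrite sqr_sqrtr // ltW.
have q0 : 0 < q by rewrite sqrtr_gt0.
have bnd s : singular_values A s -> (1 - h) * q <= s <= (1 + h) * q.
  move=> [s0 /eigenvalueP[v vs v0]].
  have N0 := qform1_gt0 v0; set N := qform 1%:M v in N0.
  have sE : qform 1%:M (v *m A^T) = s ^+ 2 * N.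
    by rewrite -qform_conj trmxK mulmx1 /qform vs -scalemxAl mxE /N /qform mulmx1.
  have yE : qform 1%:M (v *m F^T) = d * N.
    by rewrite -qform_conj trmxK mulmx1 FF' -scalemx1 qformZ.
  have zE : qform 1%:M (v *m (A - F)^T) <= h ^+ 2 * d * N.
    by rewrite -qform_conj trmxK mulmx1 hE.
  have := qform1_add_bounds (v *m F^T) (v *m (A - F)^T) h0 h1.
  have -> : v *m F^T + v *m (A - F)^T = v *m A^T.
    by rewrite -mulmxDr; congr mulmx; apply/matrixP => i j; rewrite !mxE addrC subrK.
  rewrite sE yE.
  move: zE; set Z := qform _ _ => zE /andP[lo hi].
  have hi2 : (1 + h^-1) * Z <= (1 + h^-1) * (h ^+ 2 * d * N).
    by rewrite ler_wpM2l // addr_ge0 // invr_ge0 ltW.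
  have lo2 : (h^-1 - 1) * Z <= (h^-1 - 1) * (h ^+ 2 * d * N).
    by rewrite ler_wpM2l // subr_ge0 invf_ge1 // ltW.
  have hi3 : s ^+ 2 * N <= ((1 + h) * q) ^+ 2 * N.
    apply: le_trans hi _; rewrite exprMn qq.
    apply: le_trans (lerD (lexx _) hi2) _.
    by rewrite le_eqVlt; apply/orP; left; apply/eqP; field; rewrite gt_eqF.
  have lo3 : ((1 - h) * q) ^+ 2 * N <= s ^+ 2 * N.
    apply: le_trans lo; rewrite exprMn qq.
    apply: le_trans (lerB (lexx _) lo2).
    by rewrite le_eqVlt; apply/orP; left; apply/eqP; field; rewrite gt_eqF.
  move: hi3 lo3; rewrite !ler_pM2r // => hi3 lo3; apply/andP; split.
    by rewrite -(ler_pXn2r (n := 2)) // nnegrE ?mulr_ge0 ?subr_ge0 // ltW.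
  by rewrite -(ler_pXn2r (n := 2)) // nnegrE ?mulr_ge0 ?addr_ge0 // ltW.
have [s0 hs0] := singular_values_nonempty A n0.
have smin : (1 - h) * q <= sigma_min A.
  by apply: lb_le_inf; [exists s0|move=> s /bnd /andP[]].
have smax : sigma_max A <= (1 + h) * q.
  by apply: ge_sup; [exists s0|move=> s /bnd /andP[]].
have p0 : 0 < (1 - h) * q by rewrite mulr_gt0 // subr_gt0.
have smin0 : 0 < sigma_min A by apply: lt_le_trans smin.
rewrite /cond_number gt_eqF // lee_fin ler_pdivrMr //.
apply: le_trans smax _.
have -> : (1 + h) * q = (1 + h) / (1 - h) * ((1 - h) * q).
  by field; rewrite gt_eqF // subr_gt0.
apply: ler_wpM2l; last exact: smin.
by apply: divr_ge0; lra.
Qed.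
End Condition.

(** * Choice of parameters *)

(** The orders 2^(4b+3) (4q+1) with q < 2^b form an arithmetic progression of step
2^(4b+5) that extends beyond 2^(5b). *)
Lemma hadamard_above (R : numDomainType) b n : (0 < b)%N -> (n < 2 ^ (5 * b))%N ->
  exists2 r, has_hadamard R (r + n) & (r <= 2 ^ (4 * b + 6))%N.
Proof.
move=> b0 hn; pose G := (2 ^ (4 * b + 5))%N; pose q := (n %/ G).+1.
have G0 : (0 < G)%N by rewrite expn_gt0.
have qb : (q < 2 ^ b)%N.
  have hG : G = (2 ^ (4 * b) * 32)%N by rewrite -[RHS](expnD 2 (4 * b) 5).
  have h5 : (2 ^ (5 * b) = 2 ^ (4 * b) * 2 ^ b)%N by rewrite -expnD; congr expn; lia.
  have e0 : (0 < 2 ^ (4 * b))%N by rewrite expn_gt0.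
  have f1 : (1 < 2 ^ b)%N by rewrite -{1}(expn0 2) ltn_exp2l.
  have := leq_divM n G; move: hn; rewrite /q h5 hG.
  move: e0 f1 (n %/ _)%N; move: (2 ^ (4 * b))%N (2 ^ b)%N => e f e0 f1 u hn hu.
  by rewrite ltnNge; apply/negP => fu; nia.
have hN : (2 ^ (4 * b + 3) * (4 * q + 1) = G * q + 2 ^ (4 * b + 3))%N.
  have -> : G = (2 ^ (4 * b + 3) * 4)%N by rewrite -[RHS](expnD 2 (4 * b + 3) 2) -addnA.
  by lia.
have n1 := divn_eq n G; have n2 := ltn_pmod n G0.
have e6 : (2 ^ (4 * b + 6) = 2 * G)%N by rewrite /G -expnS addnS.
have e3 : (2 ^ (4 * b + 3) <= G)%N by rewrite /G leq_exp2l // leq_add2l.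
have Gq : (G * q = n %/ G * G + G)%N by rewrite /q mulnS mulnC addnC.
exists (2 ^ (4 * b + 3) * (4 * q + 1) - n)%N; last by rewrite hN e6; lia.
rewrite subnK; last by rewrite hN; lia.
exact: hadamard_order.
Qed.

Lemma expR_dominates (R : realType) (k m : nat) : (m < k)%N ->
  (2 ^ m)%:R * expR 1 <= expR k%:R :> R.
Proof.
move=> mk; have e2 : 2 <= expR 1 :> R by apply: le_trans (expR_ge1Dx 1); lra.
case: k mk => // k mk; rewrite -natr1 expRD ler_pM2r ?expR_gt0 //.
rewrite -[k%:R]mul1r expRM_natr natrX; apply: le_trans (_ : 2 ^+ k <= _).
  by apply: ler_weXn2l => //; rewrite ler1n.
by apply: lerXn2r; rewrite ?nnegrE ?expR_ge0.
Qed.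

(** With b = 16 g, the fraction r / N of removed rows is O(beta^-8) for
beta = 4^g.  The walk is run with l = beta^3, so that l^2 r / N stays bounded,
and is stopped within t = beta^-2, where exp (l t) = exp beta exceeds every power
of n.  The rounding then has e = 4 t, and the relative error
sqrt (32 t n / d) is below 12 / beta. *)
Lemma sign_mx_near_orthogonal (R : realType) g n : (24 <= g)%N ->
    (2 ^ (80 * (g - 1)) <= n)%N -> (n < 2 ^ (80 * g))%N ->
  exists2 A : 'M[R]_n, sign_mx A &
    (cond_number A <= (1 + 48 / (4 ^ g)%:R)%:E)%E.
Proof.
move=> g24 n1 n2; pose be : R := (4 ^ g)%:R.
have [||r had rle] := @hadamard_above R (16 * g) n.
- by lia.
- by rewrite (_ : 5 * (16 * g) = 80 * g)%N //; lia.
have n0 : (0 < n)%N by apply: leq_trans n1; rewrite expn_gt0.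
have g4 : (4 ^ g = 2 ^ (2 * g))%N by rewrite expnM.
have be48 : 48 <= be.
  rewrite /be (ler_nat _ 48); apply: (@leq_trans (4 ^ 3)) => //.
  by rewrite leq_exp2l //; lia.
pose N : R := (r + n)%:R.
pose t := be ^- 2.
have t0 : 0 < t by rewrite invr_gt0 exprn_gt0 //; lra.
have t1 : t <= 1.
  by rewrite invf_le1 ?exprn_gt0 //; [rewrite exprn_ege1 //|]; lra.
have hN : (r + n <= 2 ^ (80 * g + 1))%N.
  rewrite addn1 expnS mul2n -addnn leq_add // ?(ltnW n2) //.
  by apply: leq_trans rle _; rewrite leq_exp2l //; lia.
have [||||X XX Xt] := @near_sign_orthogonal R (be ^+ 3) t r n had _ _ _ t1.
- apply: leq_trans (leq_addl _ _); apply: leq_trans n1.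
  by apply: (@leq_trans (2 ^ 3)) => //; rewrite leq_exp2l //; lia.
- by rewrite exprn_ege1 //; lra.
- rewrite /be -!natrX -natrM ler_nat g4 -!expnM.
  apply: leq_trans (leq_addl _ _); apply: leq_trans n1.
  by rewrite (_ : 128 = 2 ^ 7)%N // -expnD leq_exp2l //; lia.
- have nn : (144 * (4 ^ g) ^ 6 * r <= r + n)%N.
    apply: leq_trans (leq_addl _ _); apply: leq_trans n1; rewrite g4 -expnM.
    apply: (@leq_trans (2 ^ 8 * 2 ^ (2 * g * 6) * 2 ^ (4 * (16 * g) + 6))).
      by rewrite leq_mul // leq_mul2r orbC.
    by rewrite -!expnD leq_exp2l //; lia.
  have N0 : 0 < N by rewrite ltr0n addn_gt0 n0 orbT.
  have -> : be ^+ 3 * t = be by rewrite /t; field; rewrite gt_eqF //; lra.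
  apply: le_trans (_ : (2 ^ (160 * g + 3))%:R * expR 1 <= _); last first.
    apply: expR_dominates; have h8 : (2 ^ 8 <= 2 ^ g)%N by rewrite leq_exp2l //; lia.
    have := ltn_expl g (isT : (1 < 2)%N); move: h8; rewrite (expnMn 2 2) (_ : 2 ^ 8 = 256)%N //.
    by move: (2 ^ g)%N => e ? ?; nia.
  apply: ler_pM; rewrite ?mulr_ge0 ?exprn_ge0 ?expR_ge0 // ?ler0n //.
    rewrite -natrX -natrM ler_nat; apply: (@leq_trans (2 * (2 ^ (80 * g + 1)) ^ 2)).
      by rewrite leq_mul2l leq_exp2r.
    by rewrite -expnM -expnS leq_exp2l //; lia.
  rewrite ler_expR ler_pdivrMr // mul1r -/N.
  by rewrite -exprM /be -natrX -!natrM ler_nat.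
pose F := (1 + t)^-1 *: X.
have s0 : 0 < 1 + t by lra.
have FF : F *m F^T = ((1 + t) ^- 2 * N)%:M.
  by rewrite /F linearZ /= -scalemxAl -scalemxAr XX !scale_scalar_mx -exprVn expr2 mulrA.
have F2 i j : (1 - t) ^+ 2 <= ((1 + t) * F i j) ^+ 2 <= (1 + t) ^+ 2.
  rewrite mxE mulrA mulfV ?mul1r ?gt_eqF // -(real_normK (num_real (X i j))).
  have /andP[x1 x2] := Xt i j.
  by rewrite !lerXn2r // nnegrE ?(le_trans _ x1) //; lra.
have [|||A sA hA] := @sign_rounding R n F (4 * t).
- by lra.
- move=> i j; have /andP[_] := F2 i j; rewrite exprMn -[leRHS]mulr1 ler_pM2l ?exprn_gt0 // => h.
  by apply/andP; split; nra.
- move=> i j; have /andP[h _] := F2 i j; move: h; rewrite exprMn => h.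
  have p2 : 0 < (1 + t) ^+ 2 by rewrite exprn_gt0.
  rewrite -(ler_pM2l p2); apply: (@le_trans _ _ (4 * t)); last by nra.
  by lra.
have be0 : 0 < be by lra.
have N0 : 0 < N by rewrite ltr0n addn_gt0 n0 orbT.
have p2 : 0 < (1 + t) ^+ 2 by rewrite exprn_gt0.
pose h := 12 / be.
have h0 : 0 < h by rewrite divr_gt0.
have h4 : h <= 1 / 4 by rewrite ler_pdivrMr //; lra.
have hb : 48 / be = 4 * h by rewrite /h; field; rewrite gt_eqF.
exists A => //; apply: le_trans (cond_number_le (h := h) n0 _ h0 _ FF _) _.
- by rewrite mulr_gt0 // invr_gt0.
- by lra.
- move=> x; apply: le_trans (hA x) _; rewrite ler_wpM2r ?qform1_ge0 //.
  have -> : h ^+ 2 * ((1 + t) ^- 2 * N) = 144 * t * N / (1 + t) ^+ 2.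
    by rewrite /h /t; field; rewrite !gt_eqF // exprn_gt0.
  rewrite ler_pdivlMr //; have nN : n%:R <= N by rewrite ler_nat leq_addl.
  have p4 : (1 + t) ^+ 2 <= 4 by nra.
  have nn0 : 0 <= n%:R :> R by rewrite ler0n.
  apply: (@le_trans _ _ (8 * (4 * t) * n%:R * 4)).
    by rewrite ler_wpM2l // !mulr_ge0 //; lra.
  have : t * n%:R <= t * N by rewrite ler_pM2l.
  have : 0 <= t * N by rewrite mulr_ge0 // ltW.
  by lra.
- rewrite lee_fin hb ler_pdivrMr; last by lra.
  by nra.
Qed.

Lemma power_scale k K n : (0 < k)%N -> (2 ^ (k * K) <= n)%N ->
  exists2 g, (K < g)%N & (2 ^ (k * (g - 1)) <= n < 2 ^ (k * g))%N.
Proof.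
move=> k0 Kn; pose T := trunc_log 2 n; exists (T %/ k).+1.
  by rewrite ltnS leq_divRL // mulnC trunc_log_max.
have n0 : (0 < n)%N by apply: leq_trans Kn; rewrite expn_gt0.
have /andP[T1 T2] : (2 ^ T <= n < 2 ^ T.+1)%N by apply: trunc_log_bounds.
apply/andP; split.
  by apply: leq_trans T1; rewrite leq_exp2l // subn1 mulnC leq_divM.
by apply: leq_trans T2 _; rewrite leq_exp2l // mulnC ltn_ceil.
Qed.

Theorem theorem1 (R : realType) :
  exists alpha : R, 0 < alpha /\
    exists N : nat, forall n : nat, (0 < n)%N -> (N <= n)%N ->
      (min_cond_number R n <= (1 + 1 / (n%:R `^ alpha))%:E)%E.
Proof.
exists (80%:R^-1); split; first by rewrite invr_gt0.
exists (2 ^ (80 * 24))%N => n n0 /(power_scale (isT : (0 < 80)%N))[g g24 /andP[n1 n2]].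
have [A sA hA] := sign_mx_near_orthogonal R (ltnW g24) n1 n2.
apply: le_trans (_ : cond_number A <= _)%E.
  by apply: ereal_inf_lbound; exists A.
apply: le_trans hA _; rewrite lee_fin lerD2l.
pose c : R := (2 ^ g)%:R.
have c48 : 48 <= c.
  rewrite /c (ler_nat _ 48); apply: (@leq_trans (2 ^ 6)) => //.
  by rewrite leq_exp2l //; apply: leq_trans g24.
have c0 : 0 < c by lra.
have nc : n%:R `^ 80%:R^-1 <= c.
  have -> : c = (c ^+ 80) `^ 80%:R^-1.
    by rewrite -powR_mulrn ?(ltW c0) // -powRrM mulfV ?powRr1 ?(ltW c0) // pnatr_eq0.
  apply: ge0_ler_powR; rewrite ?invr_ge0 ?nnegrE ?exprn_ge0 ?(ltW c0) ?ler0n //.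
  by rewrite /c -natrX ler_nat -expnM mulnC ltnW.
have pn : 0 < n%:R `^ 80%:R^-1 :> R by rewrite powR_gt0 // ltr0n.
have -> : (4 ^ g)%:R = c ^+ 2 :> R by rewrite /c -natrX -expnM mulnC expnM.
apply: (@le_trans _ _ (1 / c)).
  by rewrite ler_pdivrMr ?exprn_gt0 // expr2 mulrA mul1r mulVf ?mul1r // gt_eqF.
by rewrite !mul1r lef_pV2.
Qed.
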